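(* There exist absolute constants $c,c'>0$ (not depending on $n,\sigma,\boldsymbol\mu,\delta$) such that the following holds. Let $n\ge 2$, $\sigma>0$, $\boldsymbol\mu\in\mathbb{R}^n$, and let $\mathbf{y}=\boldsymbol\mu+\boldsymbol\xi$ where $\boldsymbol\xi$ has distribution $\mathcal{N}(0,\sigma^2 I_{n\times n})$. Let $\hat{\boldsymbol\mu}^{Q}$ be the estimator defined in the context. Then for all $\delta\in(0,1/3)$, with probability at least $1-3\delta$, $$\|\hat{\boldsymbol\mu}^{Q}-\boldsymbol\mu\|^2\le \min_{\boldsymbol u\in\mathbb{R}^n}\left(\|\boldsymbol\mu-\boldsymbol u\|^2+\frac{c\,\sigma^2 k(\boldsymbol u)}{n}\log\frac{en}{k(\boldsymbol u)}\right)+\frac{c\,\sigma^2\log(1/\delta)}{n},$$ and moreover $$\mathbb{E}_{\boldsymbol\mu}\|\hat{\boldsymbol\mu}^{Q}-\boldsymbol\mu\|^2\le \min_{\boldsymbol u\in\mathbb{R}^n}\left(\|\boldsymbol\mu-\boldsymbol u\|^2+\frac{c'\sigma^2 k(\boldsymbol u)}{n}\log\frac{en}{k(\boldsymbol u)}\right).$$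
   Context: Norm: $\|\boldsymbol u\|^2=\frac1n\sum_{i=1}^n u_i^2$ for $\boldsymbol u\in\mathbb{R}^n$ (scaled Euclidean norm). $\mathbb{E}_{\boldsymbol\mu}$ is the expectation with respect to the distribution of $\mathbf{y}=\boldsymbol\mu+\boldsymbol\xi$. For $\boldsymbol u\in\mathbb{R}^n$, $k(\boldsymbol u)\ge1$ is the integer such that $k(\boldsymbol u)-1$ is the cardinality of $\{i\in\{1,\dots,n-1\}: u_{i+1}\ne u_i\}$. Estimator $\hat{\boldsymbol\mu}^{Q}$ (a function of $\mathbf{y}$, with $\sigma$ known): for every $J\subseteq\{1,\dots,n-1\}$ (including $J=\emptyset$) let $$\pi_J=\frac{\exp(-|J|)}{H\binom{n-1}{|J|}},\qquad H=\sum_{i=0}^{n-1}\exp(-i),$$ let $V_J=\{\boldsymbol u\in\mathbb{R}^n:\ u_{i+1}=u_i\ \text{for all } i\in\{1,\dots,n-1\}\setminus J\}$, and let $P_J\in\mathbb{R}^{n\times n}$ be the orthogonal projector onto $V_J$. For $\boldsymbol\theta=(\theta_J)_{J\subseteq\{1,\dots,n-1\}}$ with real entries put $\boldsymbol\mu_{\boldsymbol\theta}=\sum_{J}\theta_J P_J\mathbf{y}$. Let $\Lambda=\{\boldsymbol\theta:\ \theta_J\ge0\ \text{for all }J,\ \sum_J\theta_J=1\}$. Then $\hat{\boldsymbol\mu}^{Q}=\boldsymbol\mu_{\hat{\boldsymbol\theta}}$, where $\hat{\boldsymbol\theta}$ is a minimizer over $\boldsymbol\theta\in\Lambda$ of $$\|\boldsymbol\mu_{\boldsymbol\theta}-\mathbf{y}\|^2+\sum_{J\subseteq\{1,\dots,n-1\}}\theta_J\left(\frac{2\sigma^2|J|}{n}+\frac12\|\boldsymbol\mu_{\boldsymbol\theta}-P_J\mathbf{y}\|^2+\frac{46\sigma^2}{n}\log\frac1{\pi_J}\right).$$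 *)

(* Defs.v *)
From HB Require Import structures.
From mathcomp Require Import all_boot all_order all_algebra.
From mathcomp Require Import all_classical all_reals all_analysis.
Set Implicit Arguments.
Unset Strict Implicit.
Unset Printing Implicit Defensive.
Import Order.TTheory GRing.Theory Num.Theory.
Local Open Scope classical_set_scope.
Local Open Scope ring_scope.

(* Vectors of R^n are columns 'cV[R]_n.  The set {1, ..., n-1} of possible jump
   positions is 'I_n.-1: the (0-based) position i joins the consecutive
   coordinates [lpos i] = i and [rpos i] = i.+1 of 'I_n. *)

Definition lpos n (i : 'I_n.-1) : 'I_n := widen_ord (leq_pred n) i.

Lemma rpos_subproof n (i : 'I_n.-1) : (i.+1 < n)%N.
Proof. by rewrite -ltn_predRL. Qed.

Definition rpos n (i : 'I_n.-1) : 'I_n := Ordinal (rpos_subproof i).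

Definition jumps (R : realType) n (u : 'cV[R]_n) : {set 'I_n.-1} :=
  [set i | u (rpos i) 0 != u (lpos i) 0]%SET.

Definition npieces (R : realType) n (u : 'cV[R]_n) : nat := #|jumps u|.+1.

(* Square of the scaled Euclidean norm, including the factor 1/n. *)
Definition sqnorm (R : realType) n (u : 'cV[R]_n) : R :=
  n%:R^-1 * \sum_(i < n) u i 0 ^+ 2.

Definition is_minimum (R : realType) (A : set R) (m : R) : Prop :=
  A m /\ lbound A m.

Definition mutually_independent d (T : measurableType d) (R : realType)
    (P : probability T R) (I : finType) (X : I -> {RV P >-> R}) : Prop :=
  forall (A : {set I}) (B : I -> set R),
    (forall i, i \in A -> measurable (B i)) ->
    P (\bigcap_(i in [set` A]) (X i @^-1` B i)) =
    (\prod_(i in A) P (X i @^-1` B i))%E.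

Definition random_vector d (T : measurableType d) (R : realType)
    (P : probability T R) n (X : 'I_n -> {RV P >-> R}) (w : T) : 'cV[R]_n :=
  \col_(i < n) X i w.

(* The law N(0, sigma^2 I_n); the second parameter of [normal_prob] is the
   standard deviation. *)
Definition isotropic_gaussian d (T : measurableType d) (R : realType)
    (P : probability T R) n (sigma : R) (X : 'I_n -> {RV P >-> R}) : Prop :=
  (forall i (B : set R), measurable B ->
    distribution P (X i) B = normal_prob 0 sigma B) /\
  mutually_independent X.

Definition weight_norm (R : realType) n : R := \sum_(i < n) expR (- i%:R).

Definition prior (R : realType) n (J : {set 'I_n.-1}) : R :=
  expR (- #|J|%:R) / (weight_norm R n * 'C(n.-1, #|J|)%:R).

Definition jump_space (R : realType) n (J : {set 'I_n.-1}) : set 'cV[R]_n :=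
  [set u | forall i, i \notin J -> u (rpos i) 0 = u (lpos i) 0].

Definition is_orthogonal_projector (R : realType) n (V : set 'cV[R]_n)
    (Q : 'M[R]_n) : Prop :=
  forall x : 'cV[R]_n,
    V (Q *m x) /\ forall v, V v -> v^T *m (x - Q *m x) = 0.

(* [xget] picks the matrix satisfying the predicate; it exists by [jump_projP]
   and is unique by [jump_proj_unique] below, so the default 0 is never used. *)
Definition jump_proj (R : realType) n (J : {set 'I_n.-1}) : 'M[R]_n :=
  xget 0 [set Q | is_orthogonal_projector (jump_space J) Q].

Definition weights (R : realType) n := {ffun {set 'I_n.-1} -> R}.

Definition simplex (R : realType) n : set (weights R n) :=
  [set theta | (forall J, 0 <= theta J) /\ \sum_J theta J = 1].

Definition aggregate (R : realType) n (y : 'cV[R]_n) (theta : weights R n) :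
    'cV[R]_n :=
  \sum_J theta J *: (jump_proj R J *m y).

Definition Q_criterion (R : realType) n (sigma : R) (y : 'cV[R]_n)
    (theta : weights R n) : R :=
  sqnorm (aggregate y theta - y) +
  \sum_J theta J *
    (2 * sigma ^+ 2 * #|J|%:R / n%:R
     + 2^-1 * sqnorm (aggregate y theta - jump_proj R J *m y)
     + 46 * sigma ^+ 2 / n%:R * ln (1 / prior R J)).

Definition Q_minimizer (R : realType) n (sigma : R) (y : 'cV[R]_n)
    (theta : weights R n) : Prop :=
  simplex theta /\
  forall theta', simplex theta' ->
    Q_criterion sigma y theta <= Q_criterion sigma y theta'.

Definition oracle_risk (R : realType) n (c sigma : R) (mu u : 'cV[R]_n) : R :=
  sqnorm (mu - u) +
  c * sigma ^+ 2 * (npieces u)%:R / n%:R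
    * ln (expR 1 * n%:R / (npieces u)%:R).

Section projector.
Variable R : realType.

Lemma colsq_eq0 n (v : 'cV[R]_n) : v^T *m v = 0 -> v = 0.
Proof.
move=> /matrixP/(_ 0 0); rewrite !mxE => /eqP.
rewrite psumr_eq0 => [/allP h|i _]; last by rewrite mxE -expr2 sqr_ge0.
apply/matrixP => i j; rewrite ord1 mxE; apply/eqP.
by have := h i (mem_index_enum _); rewrite mxE -expr2 sqrf_eq0.
Qed.

Lemma kernel_projector n m (D : 'M[R]_(m, n)) :
  exists Q, is_orthogonal_projector [set u | D *m u = 0] Q.
Proof.
have [r [B [Bfree BP]]] : exists r (B : 'M[R]_(r, n)),
    row_free B /\ forall u : 'cV[R]_n, (u^T <= B)%MS <-> D *m u = 0.
  exists _, (row_base (kermx D^T)); split=> [|u]; first exact: row_base_free.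
  rewrite eq_row_base sub_kermx -trmx_mul; split=> [/eqP h|->].
    by rewrite -[D *m u]trmxK h trmx0.
  by rewrite trmx0.
pose G := B *m B^T.
have Gu : G \in unitmx.
  rewrite -row_free_unit -kermx_eq0; apply/rowV0P => x /sub_kermxP xG.
  have xB : (x *m B)^T = 0.
    by apply: colsq_eq0; rewrite trmxK trmx_mul mulmxA -[_ *m B^T]mulmxA xG mul0mx.
  by apply/(row_free_inj Bfree); rewrite mul0mx -[x *m B]trmxK xB trmx0.
exists (B^T *m (invmx G *m B)) => x; split=> [|v /BP/submxP[w vE]].
  by apply/BP; rewrite -mulmxA trmx_mul trmxK submxMl.
rewrite vE mulmxBr; apply/eqP; rewrite subr_eq0; apply/eqP.
by rewrite -!mulmxA (mulmxA B) -/G (mulKVmx Gu).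
Qed.

Lemma jump_projP n (J : {set 'I_n.-1}) :
  is_orthogonal_projector (jump_space J) (jump_proj R J).
Proof.
pose D : 'M[R]_(n.-1, n) := \matrix_(i, j)
  if i \in J then 0 else (j == rpos i)%:R - (j == lpos i)%:R.
have DE (u : 'cV[R]_n) i : (D *m u) i 0 =
    if i \in J then 0 else u (rpos i) 0 - u (lpos i) 0.
  have pick (k : 'I_n) : \sum_j (j == k)%:R * u j 0 = u k 0.
    rewrite (bigD1 k) //= eqxx mul1r big1 ?addr0 // => j /negbTE ->.
    by rewrite mul0r.
  rewrite mxE; case: ifP => iJ.
    by rewrite big1 // => j _; rewrite mxE iJ mul0r.
  under eq_bigr => j _ do rewrite mxE iJ mulrBl.
  by rewrite big_split /= sumrN !pick.
have VE : jump_space J = [set u : 'cV[R]_n | D *m u = 0].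
  apply/seteqP; split=> u /= h.
    apply/matrixP => i j; rewrite ord1 DE [RHS]mxE; case: ifPn => // iJ.
    by rewrite h ?subrr.
  move=> i iJ; apply/eqP; rewrite -subr_eq0.
  by have := DE u i; rewrite h mxE (negbTE iJ) => <-.
have [Q] := kernel_projector D; rewrite -VE => QP.
exact: (xgetI 0 QP).
Qed.

Lemma jump_proj_unique n (J : {set 'I_n.-1}) (Q : 'M[R]_n) :
  is_orthogonal_projector (jump_space J) Q -> Q = jump_proj R J.
Proof.
move=> QP; have Qx (x : 'cV[R]_n) : Q *m x = jump_proj R J *m x.
  have [VQ oQ] := QP x; have [VP oP] := jump_projP J x.
  apply/eqP; rewrite -subr_eq0; apply/eqP.
  set d := _ - _; have Vd : jump_space J d.
    move=> i iJ; have := VQ i iJ; have := VP i iJ.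
    by rewrite !mxE => -> ->.
  have dE : d = (x - jump_proj R J *m x) - (x - Q *m x).
    by rewrite opprB addrC addrA subrK.
  by apply: colsq_eq0; rewrite [X in _ *m X]dE mulmxBr (oP d Vd) (oQ d Vd) subrr.
apply/matrixP => i j; have /matrixP/(_ i 0) := Qx (delta_mx j 0).
by rewrite -!colE !mxE.
Qed.

End projector.

(* Main.v *)
Require Import Defs.
From HB Require Import structures.
From mathcomp Require Import all_boot all_order all_algebra.
From mathcomp Require Import all_classical all_reals all_analysis.
From mathcomp Require Import measurable_realfun ring lra.
Set Implicit Arguments.
Unset Strict Implicit.
Unset Printing Implicit Defensive.
Import Order.TTheory GRing.Theory Num.Theory.
Import numFieldNormedType.Exports.
Local Open Scope classical_set_scope.
Local Open Scope ring_scope.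

(** Why the theorem holds.

    Up to the factor [1 / n] and an additive constant, the criterion is the sum
    of a linear function of [theta] and of half the squared norm of the
    aggregate.  So it is 1-strongly
    convex as a function of the aggregate ([minimizer_strong_convexity]).
    Comparing the minimizer with the Dirac weights at a set [K] turns this into
    a deterministic inequality: with [p J] the projection of the data on
    [jump_space J] and [x] the noise, the loss of the estimator is at most the
    loss of [p K] plus a [theta]-average of
      [2 <x, p J - p K> - |p J - p K|^2 / 2 - penalty J + penalty K]
    ([aggregate_oracle_inequality]).  The negative squared distance is the gain
    of Q-aggregation over a plain convex combination: since [p J - p K] lies in
    [jump_space (J :|: K)], it absorbs the scalar product up to twice the squared
    norm of the projection of [x] on that space, [sigma ^+ 2] times a chi-square
    variable with at most [#|J| + #|K| + 1] degrees of freedom.  The penalty of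
    [J] contains [46 * sigma ^+ 2] times the logarithm of the inverse prior,
    which is at least [#|J|]; this is more than enough to pay for both the
    degrees of freedom and a union bound over all [J].

    The union bound is carried by one random variable [S], the prior average of
    normalized exponentials of multiples of these squared norms ([noise_control]).  It has
    mean at most 1 and its logarithm bounds all of them at once, so that Markov's
    inequality for [S] gives the bound in probability and [ln S <= S] gives the
    bound in expectation.  Taking for [K] the jump set of a best oracle vector
    [u], what remains is the estimate of the inverse prior of [K] by
    [npieces u * ln (e n / npieces u)] ([ln_inv_prior_jumps]).

    The exponential moments are computed from the moment generating function
    alone.  A vector of [jump_space W] is constant on the [#|W| + 1] blocks cut
    out by [W], so the squared norm of the projection is a sum of squares of
    scalar products with orthogonal block vectors.  Each such square is
    linearized by an auxiliary Gaussian variable ([exp_sum_squares_moment]).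

    Finally, the minimizer may be selected in an arbitrary way.  Strong
    convexity makes the aggregate, unlike the weights, unique and continuous in
    the data, hence the loss is a random variable ([risk_continuous],
    [continuous_measurable_fun_cV]). *)

(** * Inner product *)

Definition dot (R : realType) n (u v : 'cV[R]_n) : R := \sum_i u i 0 * v i 0.

Section dot_product.
Context (R : realType) (n : nat).
Implicit Types (u v w : 'cV[R]_n) (a : R).

Lemma dotC u v : dot u v = dot v u.
Proof. by apply: eq_bigr => i _; rewrite mulrC. Qed.

Lemma dotDl u v w : dot (u + v) w = dot u w + dot v w.
Proof.
by rewrite -big_split; apply: eq_bigr => i _; rewrite mxE mulrDl.
Qed.

Lemma dotZl a u v : dot (a *: u) v = a * dot u v.
Proof. by rewrite mulr_sumr; apply: eq_bigr => i _; rewrite mxE mulrA. Qed.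

Lemma dot0l v : dot 0 v = 0.
Proof. by rewrite -(scale0r v) dotZl mul0r. Qed.

Lemma dotNl u v : dot (- u) v = - dot u v.
Proof. by rewrite -scaleN1r dotZl mulN1r. Qed.

Lemma dotDr u v w : dot u (v + w) = dot u v + dot u w.
Proof. by rewrite !(dotC u) dotDl. Qed.

Lemma dotZr a u v : dot u (a *: v) = a * dot u v.
Proof. by rewrite !(dotC u) dotZl. Qed.

Lemma dotNr u v : dot u (- v) = - dot u v.
Proof. by rewrite !(dotC u) dotNl. Qed.

Lemma dot_suml (I : finType) (F : I -> 'cV[R]_n) v :
  dot (\sum_i F i) v = \sum_i dot (F i) v.
Proof.
rewrite /dot exchange_big /=; apply: eq_bigr => i _.
by rewrite summxE mulr_suml.
Qed.

Lemma dot_ge0 u : 0 <= dot u u.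
Proof. by apply: sumr_ge0 => i _; rewrite -expr2 sqr_ge0. Qed.

End dot_product.

(** * Expectations of products of independent variables *)

Section weighted.
Import HBNNSimple.

(** A weighted integral of [f] along [X] only depends on the weights that it
    gives to the level sets of simple functions converging to [f]. *)
Lemma weighted_integral_approx d d' (T : measurableType d)
    (S : measurableType d') (R : realType) (m : {measure set T -> \bar R})
    (g : T -> R) (X : T -> S) (f : S -> R) (h : ({nnsfun S >-> R})^nat) :
  measurable_fun setT g -> (forall x, 0 <= g x) -> measurable_fun setT X ->
  (forall s, (h n s)%:E @[n --> \oo] --> (f s)%:E) ->
  (forall s a b, (a <= b)%N -> h a s <= h b s) ->
  (\int[m]_x (g x * f (X x))%:E)%E =
  limn (fun n => \sum_(r \in range (h n))
    (r%:E * \int[m]_x (g x * \1_(h n @^-1` [set r]) (X x))%:E))%E.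
Proof.
move=> mg g0 mX hf hnd.
have mind (B : set S) : measurable B ->
    measurable_fun setT (fun x => (g x * \1_B (X x))%:E).
  move=> mB; apply/measurable_EFinP; apply: measurable_funM => //.
  exact: measurableT_comp.
have mgh n : measurable_fun setT (fun x => (g x * h n (X x))%:E).
  apply/measurable_EFinP; apply: measurable_funM => //.
  exact: measurableT_comp.
transitivity (limn (fun n => \int[m]_x (g x * h n (X x))%:E)%E).
  rewrite -monotone_convergence//=.
  - apply: eq_integral => x _; apply/esym/cvg_lim => //.
    under eq_fun do rewrite EFinM.
    by rewrite EFinM; apply: cvgeZl => //; exact: hf.
  - by move=> n x _; rewrite lee_fin mulr_ge0// fun_ge0.
  - move=> x _ a b ab; rewrite lee_fin ler_wpM2l//.
    exact: hnd.
congr (limn _); apply/funext => n.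
transitivity (\int[m]_x (\sum_(r \in range (h n))
    (r%:E * (g x * \1_(h n @^-1` [set r]) (X x))%:E)))%E.
  apply: eq_integral => x _; rewrite [in LHS]fimfunE EFinM -fsumEFin//.
  rewrite ge0_mule_fsumr; last first.
    by move=> r; exact: nnfun_muleindic_ge0.
  by apply: eq_fsbigr => r _; rewrite -!EFinM mulrCA.
rewrite ge0_integral_fsum//.
- apply: eq_fsbigr => r; rewrite inE => -[s _ <-].
  rewrite ge0_integralZl//.
  - exact: mind.
  - by move=> x _; rewrite lee_fin mulr_ge0.
  - by rewrite lee_fin.
- by move=> r; apply: measurable_funeM; exact: mind.
- move=> r x _; rewrite -EFinM mulrCA EFinM mule_ge0 ?lee_fin//.
  by have := nnfun_muleindic_ge0 (h n) r (X x); rewrite lee_fin.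
Qed.

(** Two weighted image measures that agree on measurable sets integrate
    nonnegative functions alike.  Weights are kept outside of the measures so
    that no density measure has to be built: the lemma serves both to replace
    one factor of a product of independent variables, and to pass from a law to
    its density. *)
Lemma weighted_integral_eq d1 d2 d (T1 : measurableType d1)
    (T2 : measurableType d2) (S : measurableType d) (R : realType)
    (m1 : {measure set T1 -> \bar R}) (m2 : {measure set T2 -> \bar R})
    (g1 : T1 -> R) (g2 : T2 -> R) (X1 : T1 -> S) (X2 : T2 -> S) (f : S -> R) :
  measurable_fun setT g1 -> measurable_fun setT g2 ->
  (forall x, 0 <= g1 x) -> (forall x, 0 <= g2 x) ->
  measurable_fun setT X1 -> measurable_fun setT X2 ->
  (forall B, measurable B ->
    (\int[m1]_x (g1 x * \1_B (X1 x))%:E = \int[m2]_x (g2 x * \1_B (X2 x))%:E)%E) ->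
  measurable_fun setT f -> (forall s, 0 <= f s) ->
  (\int[m1]_x (g1 x * f (X1 x))%:E = \int[m2]_x (g2 x * f (X2 x))%:E)%E.
Proof.
move=> mg1 mg2 g10 g20 mX1 mX2 eqB mf f0.
have mfE : measurable_fun setT (EFin \o f) by exact/measurable_EFinP.
pose h := nnsfun_approx measurableT mfE.
have hf s : (h n s)%:E @[n --> \oo] --> (f s)%:E.
  by apply: (cvg_nnsfun_approx measurableT mfE) => // x _; rewrite lee_fin.
have hnd s a b : (a <= b)%N -> h a s <= h b s.
    by move=> /(nd_nnsfun_approx measurableT mfE)/lefP; exact.
rewrite (weighted_integral_approx m1 mg1 g10 mX1 hf hnd).
rewrite (weighted_integral_approx m2 mg2 g20 mX2 hf hnd).
congr (limn _); apply/funext => n; apply: eq_fsbigr => r _.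
by rewrite eqB.
Qed.

End weighted.

(** Independence is given for indicators.  They are replaced by arbitrary
    functions one index at a time: with all the other factors as a weight, the
    case of an indicator at index [a] says that two weighted image measures
    coincide. *)
Lemma independent_integral_prod d (T : measurableType d) (R : realType)
    (P : probability T R) (I : finType) (X : I -> {RV P >-> R})
    (f : I -> R -> R) (e : I -> R) :
  mutually_independent X ->
  (forall i, measurable_fun setT (f i)) -> (forall i x, 0 <= f i x) ->
  (forall i, (\int[P]_w (f i (X i w))%:E = (e i)%:E)%E) ->
  (\int[P]_w (\prod_i f i (X i w))%R%:E = (\prod_i e i)%R%:E)%E.
Proof.
move=> indep.
suff gen (A : seq I) : forall (f : I -> R -> R) (e : I -> R),
    (forall i, measurable_fun setT (f i)) -> (forall i x, 0 <= f i x) ->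
    (forall i, (\int[P]_w (f i (X i w))%:E = (e i)%:E)%E) ->
    (forall i, i \notin A -> exists2 B, measurable B & f i = \1_B) ->
    (\int[P]_w (\prod_i f i (X i w))%R%:E = (\prod_i e i)%R%:E)%E.
  by move=> mf f0 fe; apply: (gen (enum I)) => // i; rewrite mem_enum.
(* [A] lists the indices at which [f] may fail to be an indicator. *)
elim: A => {f e} [|a A IH] f e mf f0 fe find.
  have /choice[B BP] : forall i, exists B : set R, measurable B /\ f i = \1_B.
    by move=> i; have [//|B mB fB] := find i; exists B.
  have mXB i : measurable (X i @^-1` B i).
    by rewrite -[_ @^-1` _]setTI; apply: (measurable_funPT (X i)) => //; exact: (BP i).1.
  have eE i : (e i)%:E = P (X i @^-1` B i).
    by rewrite -fe (BP i).2 -[X i @^-1` _]setIT -integral_indic.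
  rewrite -prodEFin; under eq_bigr do rewrite eE.
  transitivity (P (\bigcap_(i in [set` [set: I]%SET]) (X i @^-1` B i))).
    rewrite -[X in P X]setIT -integral_indic//; last first.
      by apply: fin_bigcap_measurable => //; exact: finite_finset.
    apply: eq_integral => w _; congr EFin; rewrite indicE.
    have [win|wnin] := boolP (_ \in _).
      rewrite big1// => i _; rewrite (BP i).2 indicE mem_set//.
      by move/set_mem : win; apply; rewrite /= finset.in_setT.
    suff [i Bi] : exists i, ~ B i (X i w).
      by rewrite (bigD1 i)//= (BP i).2 indicE memNset// mul0r.
    apply/existsNP => BX; move/negP : wnin; apply; apply/mem_set => i _.
    exact: BX.
  rewrite (indep [set: I]%SET B) => [|i _]; last exact: (BP i).1.
  by apply: eq_bigl => i; rewrite finset.in_setT.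
have meas_upd B : measurable B ->
    (\int[P]_w ((\prod_(i | i != a) f i (X i w)) * \1_B (X a w))%R%:E)%E =
    ((\prod_(i | i != a) e i) * fine (P (X a @^-1` B)))%:E.
  move=> mB; pose f' i := if i == a then \1_B : R -> R else f i.
  pose e' i := if i == a then fine (P (X a @^-1` B)) else e i.
  have mXB : measurable (X a @^-1` B).
    by rewrite -[_ @^-1` _]setTI; exact: (measurable_funPT (X a)).
  have := IH f' e'; rewrite (bigD1 a)//= /e' eqxx.
  under eq_bigr => i /negbTE ia do rewrite ia.
  rewrite mulrC => <-.
  - apply: eq_integral => w _; congr EFin.
    rewrite [RHS](bigD1 a)//= mulrC /f' eqxx; congr (_ * _).
    by apply: eq_bigr => i /negbTE ->.
  - by move=> i; rewrite /f'; case: ifP.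
  - by move=> i x; rewrite /f'; case: ifP.
  - move=> i; rewrite /f'; case: eqP => [->|_]; last exact: fe.
    rewrite fineK ?fin_num_measure//.
    by rewrite -[X a @^-1` _]setIT -integral_indic.
  - move=> i iA; rewrite /f'; case: eqP => [_|/eqP ia]; first by exists B.
    by apply: find; rewrite inE negb_or ia.
have e0 i : 0 <= e i.
  by rewrite -lee_fin -fe; apply: integral_ge0 => w _; rewrite lee_fin.
have c0 : 0 <= \prod_(i | i != a) e i by exact: prodr_ge0.
have mX i : measurable_fun setT (X i) by exact: (measurable_funPT (X i)).
transitivity (\int[P]_w ((\prod_(i | i != a) f i (X i w)) * f a (X a w))%R%:E)%E.
  by apply: eq_integral => w _; rewrite (bigD1 a)//= mulrC.
rewrite (@weighted_integral_eq _ _ _ _ _ _ _ P P _ (cst (\prod_(i | i != a) e i))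
   (X a) (X a))//=.
- under eq_integral do rewrite EFinM.
  rewrite ge0_integralZl//=.
  + by rewrite fe -EFinM [in RHS](bigD1 a)//= mulrC.
  + by apply/measurable_EFinP; exact: measurableT_comp.
  + by move=> x _; rewrite lee_fin.
- under eq_fun do rewrite -big_filter.
  by apply: measurable_prod => i _; exact: measurableT_comp.
- by move=> w; apply: prodr_ge0.
- move=> B mB; rewrite meas_upd//; under eq_integral do rewrite EFinM.
  have mXB : measurable (X a @^-1` B).
    by rewrite -[_ @^-1` _]setTI; exact: (measurable_funPT (X a)).
  rewrite ge0_integralZl//=.
  + rewrite EFinM fineK ?fin_num_measure//; congr (_ * _)%E.
    by rewrite -[X a @^-1` _]setIT -integral_indic.
  + apply/measurable_EFinP; exact: measurableT_comp.
Qed.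

(** * Gaussian moments of quadratic forms *)

(** Completing the square: an exponential tilt of a normal density is a
    multiple of another normal density. *)
Lemma normal_pdf_scale (R : realType) (a m0 m s0 s C : R) (x : R) :
  0 < s0 -> 0 < s ->
  a - (x - m0) ^+ 2 / (2 * s0 ^+ 2) = C - (x - m) ^+ 2 / (2 * s ^+ 2) ->
  expR a * normal_pdf m0 s0 x = s / s0 * expR C * normal_pdf m s x.
Proof.
move=> s0_gt0 s_gt0 aC.
have peak (r : R) : 0 < r -> normal_peak r = r^-1 * (Num.sqrt (pi *+ 2))^-1.
  move=> r0; rewrite /normal_peak -mulrnAr sqrtrM ?sqr_ge0// sqrtr_sqr.
  by rewrite gtr0_norm// invfM.
rewrite !normal_pdfE ?gt_eqF// /normal_fun !peak//.
rewrite -(mulr_natl (s0 ^+ 2)) -(mulr_natl (s ^+ 2)).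
rewrite mulrCA -expRD !mulNr aC expRD.
by field; apply/and3P; split; rewrite gt_eqF // sqrtr_gt0 pmulrn_lgt0 // pi_gt0.
Qed.

Lemma normal_mgf (R : realType) (s t : R) : 0 < s ->
  (\int[lebesgue_measure]_x (expR (x * t) * normal_pdf 0 s x)%:E =
   (expR (s ^+ 2 * t ^+ 2 / 2))%:E)%E.
Proof.
move=> s0.
transitivity (\int[lebesgue_measure]_x
  ((expR (s ^+ 2 * t ^+ 2 / 2))%:E * (normal_pdf (s ^+ 2 * t) s x)%:E))%E.
  apply: eq_integral => x _; rewrite -EFinM; congr EFin.
  rewrite (@normal_pdf_scale _ _ _ (s ^+ 2 * t) _ s (s ^+ 2 * t ^+ 2 / 2))//.
    by rewrite divff ?mul1r// gt_eqF.
  by field; rewrite gt_eqF.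
rewrite ge0_integralZl//=.
- by rewrite integral_normal_pdf mule1.
- by apply/measurable_EFinP; exact: measurable_normal_pdf.
- by move=> x _; rewrite lee_fin normal_pdf_ge0.
Qed.

(** The tilt by [x ^+ 2 / 2] turns the variance 16/25 into
    16/9 = 1 / (25/16 - 1).  Both are squares of rational numbers, which keeps
    square roots out of the constants. *)
Lemma normal_quadratic_exponential (R : realType) (t : R) :
  (\int[lebesgue_measure]_x
     (expR (x * t + x ^+ 2 / 2) * normal_pdf 0 (4 / 5) x)%:E =
   (5 / 3 * expR (8 / 9 * t ^+ 2))%:E)%E.
Proof.
transitivity (\int[lebesgue_measure]_x
  ((5 / 3 * expR (8 / 9 * t ^+ 2))%:E * (normal_pdf (16 / 9 * t) (4 / 3) x)%:E))%E.
  apply: eq_integral => x _; rewrite -EFinM; congr EFin.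
  rewrite (@normal_pdf_scale _ _ _ (16 / 9 * t) _ (4 / 3) (8 / 9 * t ^+ 2))//.
    by congr (_ * _ * _); field.
  by field.
rewrite ge0_integralZl//=.
- by rewrite integral_normal_pdf mule1.
- by apply/measurable_EFinP; exact: measurable_normal_pdf.
- by move=> x _; rewrite lee_fin normal_pdf_ge0.
Qed.

(** The vector [Z] is only known through its moment generating function,
    that of a standard Gaussian vector. *)
Section exp_sum_squares.
Context d (T : measurableType d) (R : realType) (P : probability T R) (n : nat).
Variable Z : T -> 'cV[R]_n.
Hypothesis mZ : forall t, measurable_fun setT (fun w => dot t (Z w)).
Hypothesis mgfZ : forall t,
  (\int[P]_w (expR (dot t (Z w)))%:E = (expR (dot t t / 2))%:E)%E.

(** Each [expR (8 / 25 * s ^+ 2)] is the mean of [expR (g * s)] for a normal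
    variable [g] of variance 16/25, so by Tonelli a square becomes a random
    shift of the linear term [t].  Orthogonality makes the shift along [b]
    invisible to the other vectors, hence the induction on [bs], for which [t]
    must be arbitrary.  The constants 5/3 and 8/9 are those of
    [normal_quadratic_exponential]. *)
Lemma exp_sum_squares_moment (bs : seq 'cV[R]_n) (t : 'cV[R]_n) :
  pairwise (fun a b => dot a b == 0) bs -> all (fun b => dot b b <= 1) bs ->
  (\int[P]_w (expR (dot t (Z w) + 8 / 25 * \sum_(b <- bs) dot b (Z w) ^+ 2))%:E
   <= ((5 / 3) ^+ size bs *
       expR (dot t t / 2 + 8 / 9 * \sum_(b <- bs) dot b t ^+ 2))%:E)%E.
Proof.
elim: bs t => [|b bs IH] t /=.
  move=> _ _; under eq_integral do rewrite big_nil mulr0 addr0.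
  by rewrite mgfZ big_nil mulr0 addr0 expr0 mul1r.
move=> /andP[borth orth] /andP[b1 bs1].
pose Q w := \sum_(c <- bs) dot c (Z w) ^+ 2.
pose F (z : T * R) := (expR (z.2 * dot b (Z z.1)) * normal_pdf 0 (4 / 5) z.2 *
  expR (dot t (Z z.1) + 8 / 25 * Q z.1)).
have mQ : measurable_fun setT Q.
  by apply: measurable_sum => c; apply: measurable_funX; exact: mZ.
have mE (u : 'cV[R]_n) : measurable_fun setT
    (fun w => expR (dot u (Z w) + 8 / 25 * Q w)).
  apply: measurableT_comp => //; apply: measurable_funD; first exact: mZ.
  exact: measurable_funM.
have mg c : measurable_fun setT
    (fun g : R => expR (g * c) * normal_pdf 0 (4 / 5) g).
  apply: measurable_funM; last exact: measurable_normal_pdf.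
  by apply: measurableT_comp => //; exact: measurable_funM.
have mq c : measurable_fun setT
    (fun g : R => expR (g * c + g ^+ 2 / 2) * normal_pdf 0 (4 / 5) g).
  apply: measurable_funM; last exact: measurable_normal_pdf.
  apply: measurableT_comp => //; apply: measurable_funD.
    exact: measurable_funM.
  by apply: measurable_funM => //; exact: measurable_funX.
have mF : measurable_fun setT (EFin \o F).
  apply/measurable_EFinP; apply: measurable_funM.
    apply: measurable_funM.
      apply: measurableT_comp => //; apply: measurable_funM.
        exact: measurable_snd.
      by apply: (measurableT_comp (mZ b)); exact: measurable_fst.
    by apply: (measurableT_comp (@measurable_normal_pdf R 0 (4 / 5)));
      exact: measurable_snd.
  by apply: (measurableT_comp (mE t)); exact: measurable_fst.
have F0 z : (0 <= (EFin \o F) z)%E.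
  by rewrite lee_fin !mulr_ge0 ?expR_ge0 ?normal_pdf_ge0.
have inner w : (\int[lebesgue_measure]_g (EFin \o F) (w, g) =
    (expR (dot t (Z w) + 8 / 25 * \sum_(c <- b :: bs) dot c (Z w) ^+ 2))%:E)%E.
  rewrite /F /=; under eq_integral do rewrite EFinM muleC.
  rewrite ge0_integralZl//=.
  - rewrite normal_mgf// -EFinM -expRD; congr (expR _)%:E.
    by rewrite big_cons -/(Q w); field.
  - by apply/measurable_EFinP; exact: mg.
  - by move=> g _; rewrite lee_fin mulr_ge0 ?expR_ge0 ?normal_pdf_ge0.
under eq_integral do rewrite -inner.
have swap := @fubini_tonelli _ _ _ _ _ P lebesgue_measure (EFin \o F) mF F0.
(* Given [g], the inner expectation is the induction hypothesis at
   [t + g *: b]. *)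
rewrite [leLHS]swap.
pose K : R := (5 / 3) ^+ size bs *
  expR (dot t t / 2 + 8 / 9 * \sum_(c <- bs) dot c t ^+ 2).
have outer g : (\int[P]_w (EFin \o F) (w, g) <= K%:E *
    (expR (g * dot b t + g ^+ 2 / 2) * normal_pdf 0 (4 / 5) g)%:E)%E.
  have -> : (\int[P]_w (EFin \o F) (w, g) = (normal_pdf 0 (4 / 5) g)%:E *
      \int[P]_w (expR (dot (t + g *: b) (Z w) + 8 / 25 * Q w))%:E)%E.
    rewrite -ge0_integralZl//=.
    - apply: eq_integral => w _; rewrite -EFinM /F/=; congr EFin.
      rewrite mulrAC -expRD mulrC; congr (_ * expR _).
      by rewrite dotDl dotZl; ring.
    - by apply/measurable_EFinP; exact: mE.
    - by rewrite lee_fin normal_pdf_ge0.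
  apply: (le_trans (lee_wpmul2l _ (IH (t + g *: b) orth bs1))).
    by rewrite lee_fin normal_pdf_ge0.
  rewrite -!EFinM lee_fin mulrC mulrA ler_wpM2r ?normal_pdf_ge0//.
  rewrite /K -[leRHS]mulrA ler_wpM2l ?exprn_ge0// -expRD ler_expR.
  have -> : \sum_(c <- bs) dot c (t + g *: b) ^+ 2 = \sum_(c <- bs) dot c t ^+ 2.
    apply: eq_big_seq => c cbs; rewrite dotDr dotZr (dotC c b).
    by move/allP/(_ c cbs)/eqP : borth => ->; rewrite mulr0 addr0.
  rewrite !(dotDl, dotDr, dotZl, dotZr) (dotC t b).
  have : g * (g * dot b b) <= g ^+ 2 by rewrite mulrA -expr2 ler_piMr// sqr_ge0.
  by lra.
apply: (@le_trans _ _ (\int[lebesgue_measure]_g (K%:E *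
    (expR (g * dot b t + g ^+ 2 / 2) * normal_pdf 0 (4 / 5) g)%:E))%E).
  apply: ge0_le_integral => //.
  - by move=> g _; apply: integral_ge0.
  - exact: (@measurable_fun_fubini_tonelli_G _ _ _ _ _ P (EFin \o F) mF F0).
  - apply: measurable_funeM; apply/measurable_EFinP; exact: mq.
rewrite ge0_integralZl//=.
- rewrite normal_quadratic_exponential -EFinM lee_fin.
  rewrite /K big_cons mulrDr addrCA addrC [in leRHS]expRD [in leRHS]exprS.
  by rewrite le_eqVlt; apply/orP; left; apply/eqP; ring.
- by apply/measurable_EFinP; exact: mq.
- by move=> g _; rewrite lee_fin mulr_ge0 ?expR_ge0 ?normal_pdf_ge0.
- by rewrite lee_fin mulr_ge0 ?exprn_ge0 ?expR_ge0.
Qed.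

End exp_sum_squares.

(** * Gaussian vectors and blocks of constancy *)

Lemma isotropic_gaussian_mgf d (T : measurableType d) (R : realType)
    (P : probability T R) n (sigma : R) (X : 'I_n -> {RV P >-> R})
    (t : 'cV[R]_n) :
  0 < sigma -> isotropic_gaussian sigma X ->
  (\int[P]_w (expR (dot t (random_vector X w)))%:E =
   (expR (sigma ^+ 2 * dot t t / 2))%:E)%E.
Proof.
move=> sigma0 [law indep].
have mgf i : (\int[P]_w (expR (X i w * t i 0))%:E =
    (expR (sigma ^+ 2 * t i 0 ^+ 2 / 2))%:E)%E.
  rewrite -normal_mgf//.
  transitivity (\int[P]_w (cst 1 w * expR (X i w * t i 0))%:E)%E.
    by apply: eq_integral => w _; rewrite mul1r.
  under [RHS]eq_integral do rewrite mulrC.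
  apply: (@weighted_integral_eq _ _ _ _ _ _ _ P lebesgue_measure (cst 1)
    (normal_pdf 0 sigma) (X i) id (fun x => expR (x * t i 0))) => //.
  - exact: measurable_normal_pdf.
  - by move=> x; exact: normal_pdf_ge0.
  - move=> B mB.
    have mXB : measurable (X i @^-1` B).
      by rewrite -[_ @^-1` _]setTI; exact: (measurable_funPT (X i)).
    transitivity (P (X i @^-1` B)).
      rewrite -[X i @^-1` _]setIT -integral_indic//.
      by apply: eq_integral => w _; rewrite mul1r.
    rewrite -[LHS]/(distribution P (X i) B) law// /normal_prob [LHS]integral_mkcond.
    by apply: eq_integral => x _; rewrite epatch_indic.
  - by apply: measurableT_comp => //; exact: measurable_funM.
transitivity (\int[P]_w (\prod_i expR (X i w * t i 0))%R%:E)%E.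
  apply: eq_integral => w _; rewrite -expR_sum; congr (expR _)%:E.
  by apply: eq_bigr => i _; rewrite mulrC mxE.
rewrite (@independent_integral_prod _ _ _ _ _ X (fun i x => expR (x * t i 0))
  (fun i => expR (sigma ^+ 2 * t i 0 ^+ 2 / 2)))//.
  by rewrite -expR_sum -mulr_suml -mulr_sumr.
by move=> i; apply: measurableT_comp => //; exact: measurable_funM.
Qed.

Section blocks.
Context (R : realType) (n : nat).
Implicit Types (W J K : {set 'I_n.-1}) (u x : 'cV[R]_n).

(** Two coordinates are in the same block when the same number of positions of
    [W] precede them. *)
Definition block W (i : 'I_n) : 'I_#|W|.+1 :=
  inord #|[set j in W | (j < i)%N]%SET|.

Lemma blockE W i : block W i = #|[set j in W | (j < i)%N]%SET| :> nat.
Proof.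
by rewrite inordK// ltnS subset_leq_card//; apply/fintype.subsetP => j; rewrite inE => /andP[].
Qed.

(** No position of [W] separates two coordinates of the same block. *)
Lemma jump_space_block W u i j :
  jump_space W u -> block W i = block W j -> u i 0 = u j 0.
Proof.
move=> Wu.
wlog ij : i j / (i <= j)%N => [hwlog|].
  by case/orP: (leq_total i j) => ? ?; [|symmetry]; apply: hwlog.
move=> /(congr1 val); rewrite /= !blockE.
have [k jE] : exists k, j = (i + k)%N :> nat by exists (j - i)%N; rewrite subnKC.
elim: k j jE {ij} => [|k IH] j jE bij.
  by congr (u _ 0); apply: val_inj; rewrite /= jE addn0.
have j'n : (i + k < n)%N by rewrite (leq_trans _ (ltn_ord j))// jE addnS.
pose j' := Ordinal j'n.
have sub (a b : 'I_n) : (a <= b)%N ->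
    [set l in W | (l < a)%N]%SET \subset [set l in W | (l < b)%N]%SET.
  move=> ab; apply/fintype.subsetP => l; rewrite !inE => /andP[-> la].
  exact: leq_trans la ab.
have ij' : (i <= j')%N by rewrite leq_addr.
have j'j : (j' <= j)%N by rewrite jE addnS leqnSn.
have bj' : #|[set l in W | (l < j')%N]%SET| = #|[set l in W | (l < j)%N]%SET|.
  apply/eqP; rewrite eqn_leq (subset_leq_card (sub _ _ j'j)) -bij.
  exact: (subset_leq_card (sub _ _ ij')).
rewrite (IH j')// ?bij//.
have pn : (i + k < n.-1)%N by rewrite ltn_predRL -addnS -jE.
pose p : 'I_n.-1 := Ordinal pn.
have -> : j' = lpos p by exact: val_inj.
have -> : j = rpos p by apply: val_inj; rewrite /= jE addnS.
symmetry; apply: Wu; apply/negP => pW.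
have : [set l in W | (l < j')%N]%SET \proper [set l in W | (l < j)%N]%SET.
  rewrite properE sub//=; apply/fintype.subsetPn; exists p; rewrite !inE pW/=.
    by rewrite jE addnS.
  by rewrite ltnn.
by move/proper_card; rewrite bj' ltnn.
Qed.

Definition block_size W k : R := #|[set i | block W i == k]%SET|%:R.

(** For an empty block the normalization is [0^-1 = 0], and the vector is null. *)
Definition block_unit W (k : 'I_#|W|.+1) : 'cV[R]_n :=
  (Num.sqrt (block_size k))^-1 *: \col_i (block W i == k)%:R.

Lemma dot_block_unit W k x :
  dot (block_unit k) x =
  (Num.sqrt (block_size k))^-1 * \sum_(i | block W i == k) x i 0.
Proof.
rewrite dotZl; congr (_ * _); rewrite [RHS]big_mkcond/=.
by apply: eq_bigr => i _; rewrite mxE; case: eqP; rewrite ?mul1r ?mul0r.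
Qed.

Lemma block_unit_orthogonal W (k l : 'I_#|W|.+1) :
  k != l -> dot (block_unit k) (block_unit l) = 0.
Proof.
move=> kl; rewrite dot_block_unit big1 ?mulr0// => i /eqP bk.
by rewrite !mxE bk (negbTE kl) mulr0.
Qed.

Lemma block_unit_norm W (k : 'I_#|W|.+1) :
  dot (block_unit k) (block_unit k) <= 1.
Proof.
rewrite dot_block_unit.
under eq_bigr => i bk do rewrite !mxE bk mulr1.
rewrite sumr_const mulrnAr -mulr_natr -invfM -expr2 sqr_sqrtr ?ler0n//.
rewrite /block_size cardsE.
have [->|N0] := eqVneq #|[pred i | block W i == k]| 0%N.
  by rewrite mulr0.
by rewrite mulVf// pnatr_eq0.
Qed.

(** The squared norm of the orthogonal projection of [x] on [jump_space W]. *)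
Definition block_energy W x := \sum_k dot (@block_unit W k) x ^+ 2.

(** Blockwise [2 a b <= a^2 + b^2].  In this form [block_energy] bounds the
    effect of the noise in all the directions of [jump_space W]. *)
Lemma dot_jump_space W u x :
  jump_space W u -> 2 * dot x u <= dot u u + block_energy W x.
Proof.
move=> Wu.
pose v (k : 'I_#|W|.+1) := if [pick i | block W i == k] is Some i then u i 0 else 0.
have uE i : u i 0 = v (block W i).
  rewrite /v; case: pickP => [j /eqP bj|/(_ i)]; last by rewrite eqxx.
  exact: (jump_space_block Wu).
have dotE y : dot y u = \sum_k v k * \sum_(i | block W i == k) y i 0.
  rewrite /dot (partition_big (block W) xpredT)//=.
  apply: eq_bigr => k _; rewrite mulr_sumr; apply: eq_bigr => i /eqP <-.
  by rewrite uE mulrC.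
rewrite !dotE -big_split/= mulr_sumr; apply: ler_sum => k _.
have -> : \sum_(i | block W i == k) u i 0 = block_size k * v k.
  rewrite /block_size cardsE mulr_natl -sumr_const; apply: eq_big => // i.
  by move/eqP <-.
rewrite dot_block_unit.
have [N0|Npos] := eqVneq (block_size k) 0.
  rewrite N0 mul0r mulr0 add0r big_pred0 ?mulr0 ?sqr_ge0// => i.
  apply/negP => bi; move/eqP: N0; rewrite pnatr_eq0 cards_eq0 => /eqP/setP/(_ i).
  by rewrite !inE bi.
set s := \sum_(i | _) _.
have s0 : 0 < block_size k by rewrite lt_def Npos ler0n.
set r := Num.sqrt _; have r0 : r != 0 by rewrite gt_eqF// sqrtr_gt0.
have -> : block_size k = r ^+ 2 by rewrite sqr_sqrtr// ltW.
have := sqr_ge0 (r * v k - r^-1 * s).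
have -> : (r * v k - r^-1 * s) ^+ 2 =
  v k * (r ^+ 2 * v k) + (r^-1 * s) ^+ 2 - 2 * (v k * s) by field.
by rewrite subr_ge0.
Qed.

Lemma block_energyZ W a x : block_energy W (a *: x) = a ^+ 2 * block_energy W x.
Proof.
by rewrite mulr_sumr; apply: eq_bigr => k _; rewrite dotZr exprMn.
Qed.

End blocks.

(** * The prior on jump sets *)

Section prior.
Context (R : realType).

Lemma weight_norm_ge1 n : (0 < n)%N -> 1 <= weight_norm R n.
Proof.
case: n => // n _; rewrite /weight_norm big_ord_recl oppr0 expR0 lerDl.
by apply: sumr_ge0 => i _; exact: expR_ge0.
Qed.

Lemma card_jumps_bound n (J : {set 'I_n.-1}) : (#|J| <= n.-1)%N.
Proof. by rewrite (leq_trans (max_card _))// card_ord. Qed.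

Lemma prior_gt0 n (J : {set 'I_n.-1}) : (0 < n)%N -> 0 < prior R J.
Proof.
move=> n0; rewrite /prior divr_gt0 ?expR_gt0// mulr_gt0//.
  exact: lt_le_trans (weight_norm_ge1 n0).
by rewrite ltr0n bin_gt0 card_jumps_bound.
Qed.

(** All sets of a given cardinality have the same prior, and the binomial
    coefficient in its denominator is their number. *)
Lemma sum_prior n : (0 < n)%N -> \sum_(J : {set 'I_n.-1}) prior R J = 1.
Proof.
case: n => // n _.
rewrite (partition_big (fun J : {set 'I_n} => inord #|J| : 'I_n.+1) xpredT)//=.
have H0 : weight_norm R n.+1 != 0.
  by rewrite gt_eqF// (lt_le_trans ltr01)// weight_norm_ge1.
rewrite -(divff H0) {1}/weight_norm mulr_suml; apply: eq_bigr => k _.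
have kn : (k <= n)%N by rewrite -ltnS.
have cardE (J : {set 'I_n}) : (inord #|J| == k :> 'I_n.+1) = (#|J| == k).
  by rewrite -val_eqE/= inordK// ltnS (@card_jumps_bound n.+1).
under eq_bigl do rewrite cardE.
transitivity (\sum_(J : {set 'I_n} | #|J| == k)
    (expR (- k%:R) / (weight_norm R n.+1 * 'C(n, k)%:R))).
  by apply: eq_bigr => J /eqP Jk; rewrite /prior Jk.
rewrite sumr_const.
have -> : #|[pred J : {set 'I_n} | #|J| == k]| = 'C(n, k).
  by have := card_draws 'I_n k; rewrite card_ord cardsE.
have C0 : 'C(n, k)%:R != 0 :> R by rewrite pnatr_eq0 -lt0n bin_gt0.
by rewrite -[LHS]mulr_natr; field; rewrite H0 C0.
Qed.

Lemma ln_inv_prior n (J : {set 'I_n.-1}) : (0 < n)%N ->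
  ln (1 / prior R J) =
  #|J|%:R + ln (weight_norm R n) + ln 'C(n.-1, #|J|)%:R.
Proof.
move=> n0; have H0 := lt_le_trans ltr01 (weight_norm_ge1 n0).
have C0 : 0 < 'C(n.-1, #|J|)%:R :> R by rewrite ltr0n bin_gt0 card_jumps_bound.
rewrite /prior mul1r invf_div expRN invrK lnM ?posrE ?expR_gt0 ?mulr_gt0//.
by rewrite lnM ?posrE// expRK addrC addrA.
Qed.

Lemma card_le_ln_inv_prior n (J : {set 'I_n.-1}) : (0 < n)%N ->
  #|J|%:R <= ln (1 / prior R J).
Proof.
move=> n0; rewrite ln_inv_prior// -addrA lerDl addr_ge0// ln_ge0//.
  exact: weight_norm_ge1.
by rewrite ler1n bin_gt0 card_jumps_bound.
Qed.

(** Comparison with the geometric series of ratio 1/2, as [expR 1 >= 2]. *)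
Lemma weight_norm_le2 n : weight_norm R n <= 2.
Proof.
suff : weight_norm R n <= 2 - 2 * 2^-1 ^+ n.
  by move=> /le_trans; apply; rewrite gerBl mulr_ge0 ?exprn_ge0.
rewrite /weight_norm; elim: n => [|n IH]; first by rewrite big_ord0 expr0; lra.
rewrite big_ord_recr/=.
have : expR (- n%:R) <= 2^-1 ^+ n :> R.
  rewrite -mulN1r expRM_natr lerXn2r ?nnegrE ?expR_ge0//.
  by rewrite expRN lef_pV2 ?posrE ?expR_gt0//; have := expR_ge1Dx (1 : R).
by rewrite exprS; lra.
Qed.

(** The left-hand side over the factorial is one term of the exponential
    series. *)
Lemma expn_le_fact_expR k : k%:R ^+ k <= expR k%:R * k`!%:R :> R.
Proof.
have [->|k0] := posnP k; first by rewrite expr0 expR0 mulr1.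
have := @expR_ge1Dxn R k%:R k.-1 (ler0n _ _).
rewrite prednK// -ler_pdivrMr ?ltr0n ?fact_gt0//; apply: le_trans.
by rewrite lerDr.
Qed.

(** The classical ['C(n, k) <= (e n / k)^k]; ['C(n.-1, k.-1)] is smaller. *)
Lemma ln_binomial_le n k : (0 < k <= n)%N ->
  ln 'C(n.-1, k.-1)%:R <= k%:R * ln (expR 1 * n%:R / k%:R) :> R.
Proof.
move=> /andP[k0 kn]; have n0 := leq_trans k0 kn.
have k0' : 0 < k%:R :> R by rewrite ltr0n.
have n0' : 0 < n%:R :> R by rewrite ltr0n.
have f0 : 0 < k`!%:R :> R by rewrite ltr0n fact_gt0.
have B0 : (0 < 'C(n.-1, k.-1))%N by rewrite bin_gt0 -!subn1 leq_sub2r.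
have q0 : 0 < expR 1 * n%:R / k%:R :> R by rewrite divr_gt0// mulr_gt0// expR_gt0.
rewrite mulr_natl -lnXn// ler_ln ?posrE ?exprn_gt0 ?ltr0n//.
apply: (@le_trans _ _ 'C(n, k)%:R).
  rewrite ler_nat; case: k k0 kn {k0' f0 B0 q0} => // k _ kn.
  by case: n kn {n0 n0'} => // n kn; rewrite binS leq_addl.
rewrite !exprMn exprVn ler_pdivlMr ?exprn_gt0//.
rewrite -expRM_natr mul1r mulrC.
apply: (le_trans (ler_wpM2r (ler0n _ _) (expn_le_fact_expR k))).
rewrite -mulrA ler_wpM2l ?expR_ge0// mulrC -natrM -natrX ler_nat bin_ffact.
rewrite ffact_prod -[in leqRHS](card_ord k) -prod_nat_const.
by apply: leq_prod => i _; exact: leq_subr.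
Qed.

End prior.

(** * Uniform control of the noise *)

(** One variable [S] of mean at most 1 controls the projections of the noise
    on all the spaces [jump_space (J :|: K)]: it is a prior mixture of
    exponential moments, each term of which it dominates.  This replaces a union
    bound, and bounding [ln S] gives statements both in probability and in
    expectation. *)
Lemma noise_control d (T : measurableType d) (R : realType)
    (P : probability T R) n (sigma : R) (X : 'I_n -> {RV P >-> R})
    (K : {set 'I_n.-1}) :
  (0 < n)%N -> 0 < sigma -> isotropic_gaussian sigma X ->
  exists S : T -> R, [/\ measurable_fun setT S, forall w, 0 < S w,
    (\int[P]_w (S w)%:E <= 1)%E &
    forall w (J : {set 'I_n.-1}),
      8 / 25 * block_energy (J :|: K)%SET (random_vector X w) <=
      sigma ^+ 2 * (ln (1 / prior R J) + 2 / 3 * (#|J| + #|K|).+1%:R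
                    + ln (S w))].
Proof.
move=> n0 sigma0 iso.
pose Z w := sigma^-1 *: random_vector X w.
have mZ (t : 'cV[R]_n) : measurable_fun setT (fun w => dot t (Z w)).
  apply: measurable_sum => i; apply: measurable_funM => //.
  under eq_fun do rewrite !mxE.
  exact: measurable_funM.
have mgfZ (t : 'cV[R]_n) :
    (\int[P]_w (expR (dot t (Z w)))%:E = (expR (dot t t / 2))%:E)%E.
  under eq_integral do rewrite dotZr -dotZl.
  rewrite (isotropic_gaussian_mgf _ sigma0 iso) dotZl dotZr.
  by congr (expR _)%:E; field; rewrite gt_eqF.
pose m (J : {set 'I_n.-1}) := (#|J| + #|K|).+1.
(* The factor [3 / 5] per dimension undoes the bound [(5 / 3) ^+ dim] on the
   exponential moment. *)
pose s J w := prior R J * (3 / 5) ^+ m J *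
  expR (8 / 25 * block_energy (J :|: K)%SET (Z w)).
have ms J : measurable_fun setT (s J).
  apply: measurable_funM => //; apply: measurableT_comp => //.
  apply: measurable_funM => //; apply: measurable_sum => k.
  exact: measurable_funX.
have s0 J w : 0 < s J w.
  by rewrite mulr_gt0 ?expR_gt0// mulr_gt0 ?prior_gt0// exprn_gt0// divr_gt0.
exists (fun w => \sum_J s J w); split.
- exact: measurable_sum.
- move=> w; rewrite (bigD1 finset.set0)//= ltr_pwDl// sumr_ge0// => J _.
  exact: ltW.
- under eq_integral do rewrite -sumEFin.
  rewrite ge0_integral_sum//; last 2 first.
  + by move=> J; exact/measurable_EFinP.
  + by move=> J w _; rewrite lee_fin ltW.
  rewrite -[leRHS]/((1 : R)%:E) -(sum_prior R n0) -sumEFin.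
  apply: lee_sum => J _.
  under eq_integral do rewrite EFinM.
  have q0 : 0 <= prior R J * (3 / 5) ^+ m J.
    by rewrite mulr_ge0 ?exprn_ge0 ?ltW ?prior_gt0//; lra.
  rewrite ge0_integralZl//=.
  + pose bs := [seq @block_unit R n (J :|: K)%SET k | k <- enum 'I_#|(J :|: K)%SET|.+1].
    have := @exp_sum_squares_moment _ _ _ P n Z mZ mgfZ bs 0.
    rewrite size_map size_enum_ord => main.
    have {main} : (\int[P]_w
        (expR (8 / 25 * block_energy (J :|: K)%SET (Z w)))%:E <=
        ((5 / 3) ^+ #|(J :|: K)%SET|.+1)%:E)%E.
      apply: le_trans (le_trans (main _ _) _).
      * rewrite le_eqVlt; apply/orP; left; apply/eqP; apply: eq_integral => w _.
        by rewrite big_map big_enum dot0l add0r.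
      * rewrite pairwise_map.
        have := enum_uniq 'I_#|(J :|: K)%SET|.+1; rewrite uniq_pairwise.
        by apply: sub_pairwise => k l kl /=; rewrite block_unit_orthogonal.
      * by apply/allP => _ /mapP[k _ ->]; exact: block_unit_norm.
      * rewrite lee_fin big_map big_enum big1 => [|k _]; last first.
          by rewrite dotC dot0l expr0n.
        by rewrite dot0l mulr0 mul0r addr0 expR0 mulr1.
    move=> /(lee_wpmul2l _) => /(_ (prior R J * (3 / 5) ^+ m J)%:E).
    rewrite lee_fin => /(_ q0)/le_trans; apply.
    rewrite -EFinM lee_fin -mulrA; apply: ler_piMr.
      by rewrite ltW ?prior_gt0.
    apply: (@le_trans _ _ ((3 / 5) ^+ m J * (5 / 3) ^+ m J)).
      rewrite ler_wpM2l ?exprn_ge0//.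
      apply: ler_weXn2l; first lra.
      by rewrite ltnS cardsU leq_subr.
    rewrite -exprMn (_ : 3 / 5 * (5 / 3) = 1) ?expr1n//; lra.
  + apply/measurable_EFinP; apply: measurableT_comp => //.
    apply: measurable_funM => //; apply: measurable_sum => k.
    exact: measurable_funX.
- move=> w J.
  have S0 : 0 < \sum_J s J w.
    rewrite (bigD1 finset.set0)//= ltr_pwDl// sumr_ge0// => I _; exact: ltW.
  have sS : s J w <= \sum_J s J w.
    by rewrite (bigD1 J)//= lerDl sumr_ge0// => I _; exact: ltW.
  have := sS; rewrite -ler_ln ?posrE// /s.
  have p0 := @prior_gt0 R n J n0.
  have q0 : 0 < (3 / 5 : R) ^+ m J by rewrite exprn_gt0 ?divr_gt0.
  rewrite lnM ?posrE ?expR_gt0//; last by rewrite pmulr_lgt0.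
  rewrite lnM ?posrE//.
  rewrite expRK lnXn ?divr_gt0//.
  have l35 : - ln (3 / 5 : R) <= 2 / 3.
    rewrite -lnV ?posrE ?divr_gt0//.
    rewrite (_ : (3 / 5)^-1 = 1 + 2 / 3 :> R); last lra.
    by apply: le_ln1Dx; lra.
  have lp : ln (1 / prior R J) = - ln (prior R J).
    by rewrite div1r lnV// posrE prior_gt0.
  rewrite lp /Z block_energyZ => h.
  have : - (ln (3 / 5 : R) *+ m J) <= 2 / 3 * (m J)%:R.
    by rewrite -mulNrn -[leLHS]mulr_natr ler_wpM2r.
  set E := block_energy _ _ in h *.
  move=> h2; rewrite -ler_pdivrMl ?exprn_gt0//.
  rewrite exprVn in h.
  have -> : (sigma ^+ 2)^-1 * (8 / 25 * E) = 8 / 25 * ((sigma ^+ 2)^-1 * E) by ring.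
  move: h h2; rewrite /m; lra.
Qed.

(** * Strong convexity of the criterion *)

Section criterion.
Context (R : realType) (n : nat) (sigma : R).
Hypothesis n0 : (0 < n)%N.
Implicit Types (J K : {set 'I_n.-1}) (u v x y : 'cV[R]_n) (theta : weights R n).

Lemma sqnormE u : sqnorm u = n%:R^-1 * dot u u.
Proof. by []. Qed.

Lemma dot_mulmx u v : (u^T *m v) 0 0 = dot u v.
Proof. by rewrite mxE; apply: eq_bigr => i _; rewrite mxE. Qed.

Lemma jump_proj_in J x : jump_space J (jump_proj R J *m x).
Proof. exact: (jump_projP J x).1. Qed.

Lemma dot_jump_proj J x v : jump_space J v ->
  dot v (jump_proj R J *m x) = dot v x.
Proof.
move=> Jv; have := (jump_projP J x).2 v Jv.
move/matrixP/(_ 0 0); rewrite dot_mulmx mxE dotDr dotNr => /eqP.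
by rewrite subr_eq0 => /eqP.
Qed.

Lemma jump_space_sub J u v :
  jump_space J u -> jump_space J v -> jump_space J (u - v).
Proof. by move=> Ju Jv i iJ; rewrite !mxE Ju ?Jv. Qed.

Lemma jump_spaceZ J a u : jump_space J u -> jump_space J (a *: u).
Proof. by move=> Ju i iJ; rewrite !mxE Ju. Qed.

Lemma jump_spaceS J K u : J \subset K -> jump_space J u -> jump_space K u.
Proof. by move=> JK Ju i iK; apply: Ju; apply: contraNN iK; exact: (fintype.subsetP JK). Qed.

Lemma jump_space_jumps u : jump_space (jumps u) u.
Proof. by move=> i; rewrite inE negbK => /eqP. Qed.

Lemma jumps_subset J u : jump_space J u -> jumps u \subset J.
Proof.
move=> Ju; apply/fintype.subsetP => i; rewrite inE; apply: contraNT => iJ.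
by rewrite Ju.
Qed.

(** Pythagoras. *)
Lemma dot_sub_jump_proj J x v : jump_space J v ->
  dot (x - v) (x - v) =
  dot (x - jump_proj R J *m x) (x - jump_proj R J *m x) +
  dot (jump_proj R J *m x - v) (jump_proj R J *m x - v).
Proof.
move=> Jv; set p := _ *m x.
have h1 := dot_jump_proj x Jv; have h2 := dot_jump_proj x (@jump_proj_in J x).
rewrite -/p in h1 h2.
rewrite !(dotDl, dotDr, dotNl, dotNr) (dotC x v) (dotC x p) (dotC p v) h1 h2.
by ring.
Qed.

Definition penalty J : R := 2 * sigma ^+ 2 * #|J|%:R + 46 * sigma ^+ 2 * ln (1 / prior R J).

Definition linear_part y J : R :=
  2^-1 * dot (jump_proj R J *m y) (jump_proj R J *m y)
  - 2 * dot (jump_proj R J *m y) y + penalty J.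

(** [n] times the criterion, minus the squared norm of the data: a quadratic
    function of the aggregate plus a linear function of the weights
    ([Q_criterion_objective]). *)
Definition objective y theta : R :=
  2^-1 * dot (aggregate y theta) (aggregate y theta)
  + \sum_J theta J * linear_part y J.

Lemma dot_aggregate y theta v :
  dot (aggregate y theta) v = \sum_J theta J * dot (jump_proj R J *m y) v.
Proof. by rewrite dot_suml; apply: eq_bigr => J _; rewrite dotZl. Qed.

(** The average of the squared distances to the aggregate is the average of the
    squared norms minus the squared norm of the aggregate; this removes one half
    of the quadratic part of the criterion and leaves the other half. *)
Lemma Q_criterion_objective y theta : simplex theta ->
  Q_criterion sigma y theta = n%:R^-1 * (objective y theta + dot y y).
Proof.
move=> [_ th1]; rewrite /Q_criterion /objective.
set a := aggregate y theta.
have nz : n%:R != 0 :> R by rewrite pnatr_eq0 -lt0n.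
have -> : \sum_J theta J *
    (2 * sigma ^+ 2 * #|J|%:R / n%:R +
     2^-1 * sqnorm (a - jump_proj R J *m y) +
     46 * sigma ^+ 2 / n%:R * ln (1 / prior R J)) =
  n%:R^-1 * (\sum_J theta J * linear_part y J + 2 * dot a y - 2^-1 * dot a a).
  transitivity (n%:R^-1 * (\sum_J (theta J * linear_part y J
    + 2 * (theta J * dot (jump_proj R J *m y) y)
    - theta J * dot (jump_proj R J *m y) a + 2^-1 * (theta J * dot a a)))).
    rewrite mulr_sumr; apply: eq_bigr => J _; rewrite sqnormE /linear_part /penalty.
    rewrite !(dotDl, dotDr, dotNl, dotNr) (dotC a (_ *m y)).
    by field.
  congr (_ * _); rewrite !big_split/= sumrN -!mulr_sumr -mulr_suml th1.
  by rewrite -!dot_aggregate -/a; field.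
rewrite sqnormE !(dotDl, dotDr, dotNl, dotNr) (dotC y a).
by field.
Qed.

Lemma aggregateD y theta theta' (s : R) :
  aggregate y [ffun J => theta J + s * (theta' J - theta J)] =
  aggregate y theta + s *: (aggregate y theta' - aggregate y theta).
Proof.
rewrite /aggregate -sumrB scaler_sumr -big_split; apply: eq_bigr => J _.
by rewrite ffunE scalerDl -scalerA scalerBl.
Qed.

(** Along the segment from the minimizer to [theta'], the objective is a
    quadratic polynomial with leading coefficient [D / 2]; minimality at 0 makes
    its slope at 0 nonnegative. *)
Lemma minimizer_strong_convexity y theta theta' :
  Q_minimizer sigma y theta -> simplex theta' ->
  objective y theta + 2^-1 * dot (aggregate y theta' - aggregate y theta)
    (aggregate y theta' - aggregate y theta) <= objective y theta'.
Proof.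
move=> [th_simplex th_min] th'_simplex.
set a := aggregate y theta; set a' := aggregate y theta'.
set D := dot (a' - a) (a' - a).
pose th s : weights R n := [ffun J => theta J + s * (theta' J - theta J)].
have th_in s : 0 <= s <= 1 -> simplex (th s).
  move=> /andP[s0 s1]; split.
    move=> J; rewrite ffunE.
    have := mulr_ge0 s0 (th'_simplex.1 J).
    have := mulr_ge0 (_ : 0 <= 1 - s) (th_simplex.1 J).
    by rewrite subr_ge0 => /(_ s1); lra.
  under eq_bigr do rewrite ffunE.
  rewrite big_split/= -mulr_sumr sumrB th_simplex.2 th'_simplex.2; ring.
have obj_le t : simplex t -> objective y theta <= objective y t.
  move=> tS; have := th_min _ tS.
  rewrite !Q_criterion_objective// ler_pM2l ?invr_gt0 ?ltr0n//.
  by rewrite lerD2r.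
have key s : 0 < s <= 1 ->
    objective y theta + 2^-1 * D <= objective y theta' + 2^-1 * s * D.
  move=> /andP[s0 s1].
  have /obj_le : simplex (th s) by apply: th_in; rewrite ltW.
  have -> : objective y (th s) = objective y theta
      + s * (objective y theta' - objective y theta) - 2^-1 * (s * (1 - s)) * D.
    rewrite /objective aggregateD -/a -/a' /D.
    have -> : \sum_J th s J * linear_part y J =
        \sum_J theta J * linear_part y J
        + s * (\sum_J theta' J * linear_part y J
               - \sum_J theta J * linear_part y J).
      rewrite -sumrB mulr_sumr -big_split/=; apply: eq_bigr => J _.
      by rewrite ffunE; ring.
    rewrite !(dotDl, dotDr, dotNl, dotNr, dotZl, dotZr) (dotC a' a).
    by field.
  move=> h.
  have : 0 <= s * (objective y theta' - objective y theta - 2^-1 * (1 - s) * D).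
    by lra.
  by rewrite pmulr_rge0//; lra.
apply/ler_addgt0Pr => e e0.
have D0 : 0 <= D by exact: dot_ge0.
have D1 : 0 < 1 + D by lra.
(* A step small enough for the term of second order to be below [e]. *)
pose s := Num.min 1 (e / (1 + D)).
have s01 : 0 < s <= 1 by rewrite lt_min ltr01 divr_gt0//= ge_min lexx.
apply: (le_trans (key s s01)); rewrite lerD2l.
have se : s * (1 + D) <= e by rewrite -ler_pdivlMr// ge_min lexx orbT.
have : 0 <= s * D by rewrite mulr_ge0// ltW//; case/andP: s01.
have := s01 => /andP[? _]; lra.
Qed.

End criterion.

(** * The deterministic oracle inequality *)

Section oracle.
Context (R : realType) (n : nat) (sigma : R).
Hypotheses (n0 : (0 < n)%N) (sigma0 : 0 < sigma).
Implicit Types (J K : {set 'I_n.-1}) (u v x y f : 'cV[R]_n) (theta : weights R n).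

Definition dirac_weights K : weights R n := [ffun J => (J == K)%:R].

Lemma sum_dirac_weights K (F : {set 'I_n.-1} -> R) :
  \sum_J dirac_weights K J * F J = F K.
Proof.
rewrite (bigD1 K)//= ffunE eqxx mul1r big1 ?addr0// => J /negbTE JK.
by rewrite ffunE JK mul0r.
Qed.

Lemma dirac_weights_simplex K : simplex (dirac_weights K).
Proof.
split=> [J|]; first by rewrite ffunE ler0n.
under eq_bigr => J _ do rewrite -[_ J]mulr1.
  by rewrite sum_dirac_weights.
Qed.

Lemma aggregate_dirac y K : aggregate y (dirac_weights K) = jump_proj R K *m y.
Proof.
rewrite /aggregate (bigD1 K)//= ffunE eqxx scale1r big1 ?addr0// => J /negbTE JK.
by rewrite ffunE JK scale0r.
Qed.

(** Strong convexity at the Dirac weights of [K], in which the noise [x] is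
    separated from the signal [f].  The distances from the aggregate to the
    [p J] and to [p K] recombine into the distances between [p J] and [p K]. *)
Lemma aggregate_oracle_inequality f x theta K
    (a := aggregate (f + x) theta)
    (p := fun J => jump_proj R J *m (f + x)) :
  Q_minimizer sigma (f + x) theta ->
  dot (a - f) (a - f) <= dot (p K - f) (p K - f) +
  \sum_J theta J * (2 * dot x (p J - p K) - 2^-1 * dot (p J - p K) (p J - p K)
                    - penalty sigma J + penalty sigma K).
Proof.
move=> th_min.
have th1 : \sum_J theta J = 1 by exact: th_min.1.2.
have := minimizer_strong_convexity n0 th_min (dirac_weights_simplex K).
rewrite /objective sum_dirac_weights aggregate_dirac -/a -/(p K).
set N := \sum_J theta J * dot (p J) (p J).
set Pen := \sum_J theta J * penalty sigma J.
have -> : \sum_J theta J * linear_part sigma (f + x) J =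
    2^-1 * N - 2 * dot a (f + x) + Pen.
  rewrite dot_aggregate !mulr_sumr -sumrB -big_split/=; apply: eq_bigr => J _.
  by rewrite /linear_part; ring.
have -> : \sum_J theta J * (2 * dot x (p J - p K)
      - 2^-1 * dot (p J - p K) (p J - p K) - penalty sigma J + penalty sigma K) =
    2 * dot a x - 2 * dot x (p K) - 2^-1 * N + dot a (p K)
    - 2^-1 * dot (p K) (p K) - Pen + penalty sigma K.
  pose C := - (2 * dot x (p K)) - 2^-1 * dot (p K) (p K) + penalty sigma K.
  transitivity (\sum_J (2 * (theta J * dot (p J) x)
    - 2^-1 * (theta J * dot (p J) (p J)) + theta J * dot (p J) (p K)
    - theta J * penalty sigma J + theta J * C)).
    apply: eq_bigr => J _; rewrite /C !(dotDl, dotDr, dotNl, dotNr).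
    by rewrite (dotC (p K) (p J)) (dotC x (p J)); field.
  rewrite !big_split/= !sumrN -!mulr_sumr -mulr_suml th1 -!dot_aggregate -/a.
  by rewrite -/N -/Pen /C; ring.
rewrite /linear_part -/(p K) !(dotDl, dotDr, dotNl, dotNr).
rewrite (dotC f a) (dotC (p K) a) (dotC f (p K)) (dotC x (p K)).
by lra.
Qed.

(** The loss of [p K] is a bias, at most that of [u], plus a projection of
    the noise.  Each bracket of the oracle inequality is bounded uniformly in
    [J]: the projection of the noise on [jump_space (J :|: K)] costs
    [25 / 4 * (1 + 2 / 3)] times the logarithm of the inverse prior of [J],
    which is less than the 46 in the penalty. *)
Lemma aggregate_noise_bound f x theta K u (l : R) :
  Q_minimizer sigma (f + x) theta -> jump_space K u -> 0 <= l ->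
  (forall J, 8 / 25 * block_energy (J :|: K)%SET x <=
     sigma ^+ 2 * (ln (1 / prior R J) + 2 / 3 * (#|J| + #|K|).+1%:R + l)) ->
  dot (aggregate (f + x) theta - f) (aggregate (f + x) theta - f) <=
  dot (f - u) (f - u) +
  sigma ^+ 2 * (50 * ln (1 / prior R K) + 11 * #|K|.+1%:R + 10 * l).
Proof.
move=> th_min Ku l0 hE.
have := aggregate_oracle_inequality K th_min => /= main.
set a := aggregate _ _ in main *.
pose p J := jump_proj R J *m (f + x).
have s2 : 0 < sigma ^+ 2 by rewrite exprn_gt0.
pose B : R := penalty sigma K + sigma ^+ 2 * (25 / 6 * #|K|.+1%:R + 25 / 4 * l).
have brk J : 2 * dot x (p J - p K) - 2^-1 * dot (p J - p K) (p J - p K)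
      - penalty sigma J + penalty sigma K <= B.
  (* The factor [2^-1] balances [dot_jump_space] so that only half the squared
     distance is consumed. *)
  have dJK : jump_space (J :|: K)%SET (2^-1 *: (p J - p K)).
    apply: jump_spaceZ; apply: jump_space_sub.
      by apply: (jump_spaceS (finset.subsetUl J K)); exact: jump_proj_in.
    by apply: (jump_spaceS (finset.subsetUr J K)); exact: jump_proj_in.
  have := dot_jump_space x dJK; rewrite !(dotZl, dotZr) => h1.
  have := hE J => h2.
  have h3 : sigma ^+ 2 * #|J|%:R <= sigma ^+ 2 * ln (1 / prior R J).
    by rewrite ler_pM2l// card_le_ln_inv_prior.
  have h4 : 0 <= sigma ^+ 2 * #|J|%:R by rewrite mulr_ge0// ltW.
  rewrite -[(_ + _).+1%:R]natr1 natrD in h2.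
  rewrite /B /penalty -[#|K|.+1%:R]natr1.
  by lra.
have sumB : \sum_J theta J * (2 * dot x (p J - p K)
    - 2^-1 * dot (p J - p K) (p J - p K)
    - penalty sigma J + penalty sigma K) <= B.
  have -> : B = \sum_J theta J * B by rewrite -mulr_suml th_min.1.2 mul1r.
  apply: ler_sum => J _.
  by apply: ler_wpM2l; [exact: th_min.1.1|exact: brk].
have bias : dot (p K - f) (p K - f) <=
    dot (f - u) (f - u) + block_energy K x.
  set pf := jump_proj R K *m f; set px := jump_proj R K *m x.
  have pE : p K = pf + px by rewrite /p mulmxDr.
  have := dot_sub_jump_proj f (@jump_proj_in R n K (f + x)); rewrite -/pf -/(p K) pE.
  have := dot_sub_jump_proj f Ku; rewrite -/pf.
  have := dot_jump_space x (@jump_proj_in R n K x); rewrite -/px.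
  have := dot_jump_proj x (@jump_proj_in R n K x); rewrite -/px (dotC px x) => <-.
  have := dot_ge0 (pf - u).
  rewrite !(dotDl, dotDr, dotNl, dotNr) (dotC f px) (dotC f pf) (dotC px pf) (dotC f u) (dotC pf u).
  by lra.
have := hE K; rewrite finset.setUid -[(_ + _).+1%:R]natr1 natrD => hK.
move: main; rewrite -/(p K) => main.
have := le_trans main (lerD bias sumB) => main2.
apply: (le_trans main2); rewrite /B /penalty -[#|K|.+1%:R]natr1.
have h3 : sigma ^+ 2 * #|K|%:R <= sigma ^+ 2 * ln (1 / prior R K).
  by rewrite ler_pM2l// card_le_ln_inv_prior.
have h4 : 0 <= sigma ^+ 2 * #|K|%:R by rewrite mulr_ge0// ltW.
have h5 : 0 <= sigma ^+ 2 * l by rewrite mulr_ge0// ltW.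
by lra.
Qed.

Lemma npieces_bounds u : (0 < npieces u <= n)%N.
Proof. by rewrite /npieces/= -[leqRHS](prednK n0) ltnS card_jumps_bound. Qed.

Lemma ln_pieces_ge1 k : (0 < k <= n)%N -> 1 <= ln (expR 1 * n%:R / k%:R) :> R.
Proof.
move=> /andP[k0 kn]; rewrite -[leLHS]expRK ler_ln ?posrE ?expR_gt0//.
  by rewrite ler_pdivlMr ?ltr0n// ler_wpM2l ?expR_ge0// ler_nat.
by rewrite divr_gt0 ?mulr_gt0 ?expR_gt0 ?ltr0n.
Qed.

(** In [ln_inv_prior], the first two terms together are at most [npieces u],
    since [weight_norm R n <= 2]; the third is bounded by [ln_binomial_le]. *)
Lemma ln_inv_prior_jumps u :
  ln (1 / prior R (jumps u)) <=
  2 * ((npieces u)%:R * ln (expR 1 * n%:R / (npieces u)%:R)).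
Proof.
have kn := npieces_bounds u; rewrite ln_inv_prior//.
have := @ln_binomial_le R _ _ kn; rewrite -[(npieces u).-1]/#|jumps u| => h.
have h1 : (npieces u)%:R <= (npieces u)%:R * ln (expR 1 * n%:R / (npieces u)%:R) :> R.
  by rewrite ler_peMr// ln_pieces_ge1.
have h2 : ln (weight_norm R n) <= 1.
  have := weight_norm_le2 R n; have := @weight_norm_ge1 R n n0 => w1 w2.
  have := @le_ln1Dx R (weight_norm R n - 1); rewrite addrCA subrr addr0.
  by move=> /(_ _)/le_trans; apply; lra.
have : #|jumps u|%:R + 1 = (npieces u)%:R :> R by rewrite natr1.
by lra.
Qed.

(** The constant is [111 = 50 * 2 + 11], where 2 comes from
    [ln_inv_prior_jumps]. *)
Lemma aggregate_risk_bound f x theta u (l : R) :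
  Q_minimizer sigma (f + x) theta -> 0 <= l ->
  (forall J, 8 / 25 * block_energy (J :|: jumps u)%SET x <=
     sigma ^+ 2 * (ln (1 / prior R J) + 2 / 3 * (#|J| + #|jumps u|).+1%:R + l)) ->
  sqnorm (aggregate (f + x) theta - f) <=
  oracle_risk 111 sigma f u + 10 * sigma ^+ 2 * l / n%:R.
Proof.
move=> th_min l0 hE.
have := aggregate_noise_bound th_min (@jump_space_jumps R n u) l0 hE.
rewrite -/(npieces u) => main.
have h1 := ln_inv_prior_jumps u.
have h2 : (npieces u)%:R <= (npieces u)%:R * ln (expR 1 * n%:R / (npieces u)%:R) :> R.
  by rewrite ler_peMr// ln_pieces_ge1// npieces_bounds.
rewrite /oracle_risk !sqnormE.
set L := ln (expR 1 * n%:R / _) in h1 h2 *.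
have -> : n%:R^-1 * dot (f - u) (f - u) +
    111 * sigma ^+ 2 * (npieces u)%:R / n%:R * L + 10 * sigma ^+ 2 * l / n%:R =
  n%:R^-1 * (dot (f - u) (f - u) + sigma ^+ 2 * (111 * ((npieces u)%:R * L) + 10 * l)).
  by ring.
rewrite ler_pM2l ?invr_gt0 ?ltr0n//; apply: (le_trans main).
by rewrite lerD2l ler_pM2l ?exprn_gt0//; lra.
Qed.

(** By [ln (1 + x) <= x], the increment from [k] to [k'] is at least
    [(k' - k) * (ln (e n / k') - 1)], and this is nonnegative up to [n]. *)
Lemma complexity_le (k k' : nat) : (0 < k)%N -> (k <= k' <= n)%N ->
  k%:R * ln (expR 1 * n%:R / k%:R) <= k'%:R * ln (expR 1 * n%:R / k'%:R) :> R.
Proof.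
move=> k0 /andP[kk' k'n]; have k'0 := leq_trans k0 kk'.
have L1 : 1 <= ln (expR 1 * n%:R / k'%:R) :> R by rewrite ln_pieces_ge1// k'0.
have kp : 0 < k%:R :> R by rewrite ltr0n.
have k'p : 0 < k'%:R :> R by rewrite ltr0n.
have np : 0 < n%:R :> R by rewrite ltr0n.
have -> : expR 1 * n%:R / k%:R = (expR 1 * n%:R / k'%:R) * (1 + (k'%:R / k%:R - 1)) :> R.
  by field; rewrite !gt_eqF.
have r0 : 0 < k'%:R / k%:R :> R by rewrite divr_gt0.
rewrite lnM ?posrE; last 2 first.
- by rewrite divr_gt0// mulr_gt0// expR_gt0.
- by rewrite addrCA subrr addr0.
have := @le_ln1Dx R (k'%:R / k%:R - 1); rewrite ltrBrDl subrr => /(_ r0) h.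
have : k%:R * ln (1 + (k'%:R / k%:R - 1)) <= k'%:R - k%:R :> R.
  apply: (le_trans (ler_wpM2l (ltW kp) h)).
  by rewrite mulrBr mulr1 mulrCA divff ?mulr1// gt_eqF.
have : (k'%:R - k%:R) * 1 <= (k'%:R - k%:R) * ln (expR 1 * n%:R / k'%:R) :> R.
  by rewrite ler_wpM2l// subr_ge0 ler_nat.
rewrite mulrDr; set L := ln (_ / k'%:R).
by lra.
Qed.

(** Projecting the signal on [jump_space (jumps u)] decreases the distance
    and can only remove jumps.  So the projections on the finitely many spaces
    contain a minimizer. *)
Lemma oracle_risk_min (c : R) f : 0 <= c -> exists u0, forall u,
  oracle_risk c sigma f u0 <= oracle_risk c sigma f u.
Proof.
move=> c0; pose q J := jump_proj R J *m f.
pose risk J := oracle_risk c sigma f (q J).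
have [J _ Jmin] := @arg_minP _ R _ (finset.set0 : {set 'I_n.-1}) xpredT risk isT.
exists (q J) => u; apply: (le_trans (Jmin (jumps u) isT)).
rewrite /risk /oracle_risk; apply: lerD.
  rewrite !sqnormE ler_pM2l ?invr_gt0 ?ltr0n//.
  by rewrite (dot_sub_jump_proj f (@jump_space_jumps R n u)) lerDl dot_ge0.
have assoc (k L : R) : c * sigma ^+ 2 * k / n%:R * L = c * sigma ^+ 2 / n%:R * (k * L).
  by ring.
rewrite !assoc; apply: ler_wpM2l.
  by rewrite divr_ge0 ?ler0n// mulr_ge0// sqr_ge0.
apply: complexity_le => //; case/andP: (npieces_bounds u) => _ ->.
rewrite andbT ltnS subset_leq_card//; apply: jumps_subset.
exact: jump_proj_in.
Qed.

End oracle.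

(** * Continuity and measurability of the estimator *)

Section measurability.
Context d (T : measurableType d) (R : realType) (n : nat).
Variable Y : T -> 'cV[R]_n.
Hypothesis mY : forall i, measurable_fun setT (fun w => Y w i 0).

(** An open set is a countable union of boxes with rational centres and radii
    [1 / k.+1]. *)
Lemma open_preimage_measurable_cV (A : set 'cV[R]_n) :
  open A -> measurable (Y @^-1` A).
Proof.
move=> oA.
pose box (p : 'cV[rat]_n * nat) : set 'cV[R]_n :=
  [set v | forall i, `|v i 0 - ratr (p.1 i 0)| < p.2.+1%:R^-1].
have -> : Y @^-1` A =
    \bigcup_p (if pselect (box p `<=` A) then Y @^-1` box p else set0).
  apply/seteqP; split=> [w AYw|w [p _]]; last first.
    by case: pselect => [boxA /= |//] boxw; exact: boxA.
  have /nbhs_ballP[e /= e0 eA] : nbhs (Y w) A by exact: open_nbhs_nbhs.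
  have e2 : 0 < e / 2 by rewrite divr_gt0.
  have [k _ ke] := near_infty_natSinv_lt (PosNum e2).
  have {}ke : k.+1%:R^-1 < e / 2 by exact: (ke k (leqnn k)).
  have k0 : 0 < k.+1%:R^-1 :> R by rewrite invr_gt0 ltr0n.
  set r : R := k.+1%:R^-1 in k0 ke.
  have /choice[q qP] : forall i, exists q : rat, `|Y w i 0 - ratr q| < r.
    move=> i; have /rat_in_itvoo[q] : Y w i 0 - r < Y w i 0 + r.
      by lra.
    by rewrite in_itv/= => /andP[q1 q2]; exists q; rewrite ltr_norml; lra.
  exists (\col_i q i, k) => //=; case: pselect => [_ i|]; first by rewrite mxE.
  case=> v vbox; apply: eA; split=> // i j; rewrite ord1 /ball/=.
  have := vbox i; rewrite /= -/r; have := qP i; rewrite mxE !ltr_norml.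
  move=> /andP[? ?] /andP[? ?]; apply/andP; split; lra.
apply: countable_bigcupT_measurable => [|p]; first exact: countableP.
case: pselect => [?|?] /=; last exact: measurable0.
have -> : Y @^-1` box p = \bigcap_(i in [set: 'I_n])
    ((fun w => Y w i 0) @^-1` ball (ratr (p.1 i 0) : R) p.2.+1%:R^-1).
  apply/seteqP; split=> w /= h i; first by move=> _; rewrite /ball/= distrC.
  by have := h i I; rewrite /ball/= distrC.
apply: fin_bigcap_measurable => [|i _]; first exact: finite_finset.
by rewrite -[_ @^-1` _]setTI; apply: mY => //; exact: measurable_ball.
Qed.

Lemma continuous_measurable_fun_cV (g : 'cV[R]_n -> R) :
  continuous g -> measurable_fun setT (g \o Y).
Proof.
move=> /continuousP cg; apply: (measurability _ (RGenOpens.measurableE R)).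
move=> _ [_ [a [b ->] <-]]; rewrite setTI comp_preimage.
exact/open_preimage_measurable_cV/cg/interval_open.
Qed.

End measurability.

Section continuity.
Context (R : realType) (n : nat) (sigma : R).
Hypothesis n0 : (0 < n)%N.
Implicit Types (J : {set 'I_n.-1}) (u v h y z f : 'cV[R]_n) (theta : weights R n).

Lemma dot_jump_proj_le J y :
  dot (jump_proj R J *m y) (jump_proj R J *m y) <= dot y y.
Proof.
have := dot_jump_proj y (@jump_proj_in R n J y).
have := dot_ge0 (y - jump_proj R J *m y).
rewrite !(dotDl, dotDr, dotNl, dotNr) (dotC y (_ *m y)).
by move=> h E; lra.
Qed.

Lemma aggregateDy theta y z :
  aggregate (y + z) theta = aggregate y theta + aggregate z theta.
Proof.
rewrite /aggregate -big_split; apply: eq_bigr => J _.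
by rewrite mulmxDr scalerDr.
Qed.

Lemma dot_aggregate_le theta y : simplex theta ->
  dot (aggregate y theta) (aggregate y theta) <= dot y y.
Proof.
move=> [th0 th1]; set a := aggregate y theta.
suff : dot a a <= 2^-1 * (dot y y + dot a a) by lra.
have -> : 2^-1 * (dot y y + dot a a) =
    \sum_J theta J * (2^-1 * (dot y y + dot a a)).
  by rewrite -mulr_suml th1 mul1r.
rewrite [leLHS]dot_aggregate; apply: ler_sum => J _.
apply: ler_wpM2l => //.
have := dot_jump_proj_le J y; set p := _ *m y.
have := dot_ge0 (p - a).
by rewrite !(dotDl, dotDr, dotNl, dotNr) (dotC a p); lra.
Qed.

(** Continuity of the squared norm, uniform for [u] in a bounded set. *)
Lemma dot_perturbation u h (s B : R) : 0 < s <= 1 -> dot h h <= s ^+ 2 ->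
  dot u u <= B -> `|dot (u + h) (u + h) - dot u u| <= s * (B + 2).
Proof.
move=> /andP[s0 s1] hs uB.
have p1 := dot_ge0 (s *: u - h); have p2 := dot_ge0 (s *: u + h).
move: p1 p2; rewrite !(dotDl, dotDr, dotNl, dotNr, dotZl, dotZr) (dotC h u) => p1 p2.
have ss : s ^+ 2 <= s by rewrite expr2 ler_piMl// ltW.
have q1 : s * (2 * dot u h) <= s * (s * (B + 1)).
  have : s ^+ 2 * dot u u <= s ^+ 2 * B by rewrite ler_wpM2l ?sqr_ge0.
  by lra.
have q2 : s * - (2 * dot u h) <= s * (s * (B + 1)).
  have : s ^+ 2 * dot u u <= s ^+ 2 * B by rewrite ler_wpM2l ?sqr_ge0.
  by lra.
rewrite ler_pM2l// in q1; rewrite ler_pM2l// in q2.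
have h0 := dot_ge0 h.
by rewrite ler_norml; apply/andP; split; lra.
Qed.

(** Uniformity in the weights holds since convex combinations of projections
    are contractions. *)
Lemma objective_perturbation theta y h (s : R) : simplex theta ->
  0 < s <= 1 -> dot h h <= s ^+ 2 ->
  `|objective sigma (y + h) theta - objective sigma y theta| <=
  2 * s * (dot y y + 2).
Proof.
move=> th s01 hs.
have lin z : \sum_J theta J * linear_part sigma z J =
    - (3 / 2) * \sum_J theta J * dot (jump_proj R J *m z) (jump_proj R J *m z)
    + \sum_J theta J * penalty sigma J.
  rewrite mulr_sumr -big_split/=; apply: eq_bigr => J _.
  rewrite /linear_part -(dot_jump_proj z (@jump_proj_in R n J z)).
  by field.
rewrite /objective !lin aggregateDy.
set u := aggregate y theta; set hu := aggregate h theta.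
have b1 : `|dot (u + hu) (u + hu) - dot u u| <= s * (dot y y + 2).
  apply: dot_perturbation => //; last exact: dot_aggregate_le.
  exact: le_trans (dot_aggregate_le _ th) hs.
pose N z := \sum_J theta J * dot (jump_proj R J *m z) (jump_proj R J *m z).
have b2 : `|N (y + h) - N y| <= s * (dot y y + 2).
  rewrite /N -sumrB; under eq_bigr do rewrite -mulrBr.
  have -> : s * (dot y y + 2) = \sum_J theta J * (s * (dot y y + 2)).
    by rewrite -mulr_suml th.2 mul1r.
  apply: (le_trans (ler_norm_sum _ _ _)); apply: ler_sum => J _.
  rewrite normrM (ger0_norm (th.1 J)); apply: ler_wpM2l; first exact: th.1.
  rewrite mulmxDr; apply: dot_perturbation => //; last exact: dot_jump_proj_le.
  exact: le_trans (dot_jump_proj_le _ _) hs.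
move: b1 b2; rewrite -/(N (y + h)) -/(N y) !ler_norml => /andP[? ?] /andP[? ?].
by apply/andP; split; lra.
Qed.

(** Both minimizers are almost optimal for the same data, so strong convexity
    brings their aggregates together, whatever the weights are. *)
Lemma aggregate_minimizer_perturbation theta theta' y h (s : R)
    (D := aggregate (y + h) theta' - aggregate y theta) :
  Q_minimizer sigma y theta -> Q_minimizer sigma (y + h) theta' ->
  0 < s <= 1 -> dot h h <= s ^+ 2 ->
  dot D D <= 18 * s * (dot y y + 2).
Proof.
move=> m1 m2 s01 hs.
have h1 := minimizer_strong_convexity n0 m1 m2.1.
have h2 := minimizer_strong_convexity n0 m2 m1.1.
have := objective_perturbation y m1.1 s01 hs.
have := objective_perturbation y m2.1 s01 hs.
have h3 := dot_ge0 (aggregate (y + h) theta - aggregate (y + h) theta').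
rewrite !ler_norml => /andP[? ?] /andP[? ?].
set v := aggregate y theta' - aggregate y theta in h1.
have v_le : dot v v <= 8 * s * (dot y y + 2) by lra.
have -> : D = aggregate h theta' + v by rewrite /D /v aggregateDy addrAC addrC.
clearbody v.
have h4 := dot_ge0 (aggregate h theta' - v).
have h5 := le_trans (dot_aggregate_le h m2.1) hs.
have s2 : s ^+ 2 <= s.
  by case/andP: s01 => ? ?; rewrite expr2 ler_piMl// ltW.
have := dot_ge0 y => y0.
have sy : 0 <= s * dot y y by rewrite mulr_ge0// ltW//; case/andP: s01.
move: h4; rewrite !(dotDl, dotDr, dotNl, dotNr) (dotC v (aggregate h theta')).
by lra.
Qed.

(** The weights may jump but the aggregate may not.  The moduli [s] for the data and [t] for the
    aggregate come from [aggregate_minimizer_perturbation] and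
    [dot_perturbation]. *)
Lemma risk_continuous (thetahat : 'cV[R]_n -> weights R n) f :
  (forall z, Q_minimizer sigma z (thetahat z)) ->
  continuous (fun z => sqnorm (aggregate z (thetahat z) - f)).
Proof.
move=> th_min z; have zF := @nbhs_filter _ (z : 'cV[R]_n : topologicalType).
apply/cvgrPdist_le => /= e e0.
set u := aggregate z (thetahat z) - f.
pose B := dot u u + 2; have B0 : 0 < B by rewrite ltr_wpDl ?dot_ge0.
pose t := Num.min 1 (e / B).
have t01 : 0 < t <= 1 by rewrite lt_min ltr01 divr_gt0//= ge_min lexx.
have tB : t * B <= e by rewrite -ler_pdivlMr// ge_min lexx orbT.
pose C := 18 * (dot z z + 2).
have C0 : 0 < C by rewrite mulr_gt0// ltr_wpDl ?dot_ge0.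
pose s := Num.min 1 (t ^+ 2 / C).
have t0 : 0 < t by case/andP: t01.
have s01 : 0 < s <= 1.
  by rewrite lt_min ltr01 divr_gt0 ?exprn_gt0//= ge_min lexx.
have sC : s * C <= t ^+ 2 by rewrite -ler_pdivlMr// ge_min lexx orbT.
have s0 : 0 < s by case/andP: s01.
have n1 : 1 <= n%:R :> R by rewrite ler1n.
have np : 0 < n%:R :> R by rewrite ltr0n.
have r0 : 0 < s / n%:R by rewrite divr_gt0.
apply: filterS (nbhsx_ballx z _ r0) => z' [_ zz'].
have hs : dot (z' - z) (z' - z) <= s ^+ 2.
  apply: (@le_trans _ _ (\sum_(i < n) s ^+ 2 / n%:R)); last first.
    by rewrite sumr_const card_ord -[leLHS]mulr_natr divfK// gt_eqF.
  apply: ler_sum => i _; rewrite !mxE -expr2 -real_normK ?num_real//.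
  have := zz' i 0; rewrite /ball/= distrC => /ltW zi.
  apply: (@le_trans _ _ ((s / n%:R) ^+ 2)).
    by rewrite lerXn2r ?nnegrE// divr_ge0// ltW.
  rewrite exprMn ler_wpM2l ?sqr_ge0// expr2 ler_piMl ?invr_ge0 ?ler0n//.
  by rewrite invf_le1.
have z'E : z + (z' - z) = z' by rewrite addrC subrK.
have m2 : Q_minimizer sigma (z + (z' - z)) (thetahat z') by rewrite z'E.
have := aggregate_minimizer_perturbation (th_min z) m2 s01 hs; rewrite z'E /=.
set D := _ - aggregate z _ => DD.
have Dt : dot D D <= t ^+ 2 by rewrite (le_trans DD)// mulrAC -/C mulrC.
have -> : aggregate z' (thetahat z') - f = u + D.
  by rewrite /D /u [RHS]addrC addrA subrK.
rewrite !sqnormE -mulrBr normrM distrC gtr0_norm ?invr_gt0//.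
have := dot_perturbation t01 Dt (lexx (dot u u)); rewrite -/B => h.
apply: le_trans tB; apply: le_trans h.
by rewrite ler_piMl// invf_le1.
Qed.

End continuity.

(** * Risk bounds in probability and in expectation *)

(** Markov's inequality for the complementary event. *)
Lemma markov_mean_le1 d (T : measurableType d) (R : realType)
    (P : probability T R) (S : T -> R) (delta : R) :
  measurable_fun setT S -> (forall w, 0 <= S w) ->
  (\int[P]_w (S w)%:E <= 1)%E -> 0 < delta ->
  ((1 - delta)%:E <= P [set w | S w <= 1 / delta]%R)%E.
Proof.
move=> mS S0 S1 d0.
pose A := [set w | S w <= 1 / delta].
have mA : measurable A.
  rewrite (_ : A = S @^-1` `]-oo, 1 / delta]); last first.
    by apply/seteqP; split=> w; rewrite /A /= in_itv.
  by rewrite -[_ @^-1` _]setTI; exact: mS.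
have PA : (P (~` A) <= delta%:E)%E.
  have : ((1 / delta)%:E * P (~` A) <= 1)%E.
    apply: le_trans S1.
    have := @integral_cst _ _ _ P (~` A) (measurableC mA) (1 / delta)%:E.
    move=> /esym ->; rewrite integral_mkcond; apply: ge0_le_integral => //.
    - by move=> w _; rewrite patchE; case: ifP => // _; rewrite lee_fin divr_ge0// ltW.
    - by apply/(measurable_restrictT _ (measurableC mA)); exact: measurable_cst.
    - exact/measurable_EFinP.
    - move=> w _; rewrite patchE; case: ifPn => [|_]; last by rewrite lee_fin.
      by rewrite inE /A /= => /negP; rewrite -ltNge lee_fin => /ltW.
  rewrite -[P (~` A)]fineK ?fin_num_measure//; last exact: measurableC.
  by rewrite -EFinM !lee_fin mul1r mulrC ler_pdivrMr// mul1r.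
rewrite -/A -[A]setCK probability_setC; last exact: measurableC.
by rewrite EFinB leeB.
Qed.

(** The complexity term [npieces u * ln (e n / npieces u)] is at least 1, so a
    residual of order [sigma ^+ 2 / n] only changes the constant. *)
Lemma oracle_riskD (R : realType) n (a b sigma : R) (mu u : 'cV[R]_n) :
  (0 < n)%N -> 0 <= b ->
  oracle_risk a sigma mu u + b * sigma ^+ 2 / n%:R <=
  oracle_risk (a + b) sigma mu u.
Proof.
move=> n0 b0; rewrite /oracle_risk -addrA lerD2l.
have k1 : 1 <= (npieces u)%:R * ln (expR 1 * n%:R / (npieces u)%:R) :> R.
  have kn := npieces_bounds n0 u; case/andP: (kn) => k0 _.
  apply: (@le_trans _ _ (npieces u)%:R); first by rewrite ler1n.
  by rewrite ler_peMr// ln_pieces_ge1.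
set k := (npieces u)%:R in k1 *; set L := ln _ in k1 *.
have -> : (a + b) * sigma ^+ 2 * k / n%:R * L =
  a * sigma ^+ 2 * k / n%:R * L + b * sigma ^+ 2 / n%:R * (k * L) by ring.
by rewrite lerD2l ler_peMr// divr_ge0 ?ler0n// mulr_ge0// sqr_ge0.
Qed.

Lemma oracle_risk_ge0 (R : realType) n (c sigma : R) (mu u : 'cV[R]_n) :
  (0 < n)%N -> 0 <= c -> 0 <= oracle_risk c sigma mu u.
Proof.
move=> n0 c0; rewrite /oracle_risk addr_ge0//.
  by rewrite sqnormE mulr_ge0 ?invr_ge0 ?ler0n ?dot_ge0.
apply: mulr_ge0.
  by rewrite divr_ge0 ?ler0n// mulr_ge0 ?ler0n// mulr_ge0 ?sqr_ge0.
exact: le_trans ler01 (ln_pieces_ge1 R n0 (npieces_bounds n0 u)).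
Qed.

Theorem theorem1 (R : realType) :
  exists c c' : R, 0 < c /\ 0 < c' /\
  forall (n : nat) (sigma : R) (mu : 'cV[R]_n)
    (d : measure_display) (T : measurableType d) (P : probability T R)
    (xi : 'I_n -> {RV P >-> R})
    (thetahat : 'cV[R]_n -> weights R n),
  (2 <= n)%N -> 0 < sigma ->
  isotropic_gaussian sigma xi ->
  (forall z : 'cV[R]_n, Q_minimizer sigma z (thetahat z)) ->
  let y : T -> 'cV[R]_n := fun w => mu + random_vector xi w in
  let muQ : 'cV[R]_n -> 'cV[R]_n := fun z => aggregate z (thetahat z) in
  (exists m : R,
    is_minimum [set oracle_risk c sigma mu u | u in [set: 'cV[R]_n]] m /\
    forall delta : R, 0 < delta -> delta < 1 / 3 ->
      ((1 - 3 * delta)%:E <=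
       P [set w | (sqnorm (muQ (y w) - mu) <=
                   m + c * sigma ^+ 2 * ln (1 / delta) / n%:R)%R])%E) /\
  (exists m' : R,
    is_minimum [set oracle_risk c' sigma mu u | u in [set: 'cV[R]_n]] m' /\
    ('E_P[fun w => sqnorm (muQ (y w) - mu)] <= m'%:E)%E).
Proof.
(* 111 comes from [aggregate_risk_bound], and 10 pays for the mean of [S]. *)
exists 121, 121; split=> //; split=> // n sigma mu d T P xi thetahat n2 sigma0.
move=> iso th_min y muQ.
have n0 : (0 < n)%N by exact: leq_trans n2.
have np : 0 < n%:R :> R by rewrite ltr0n.
have c0 : 0 <= 121 :> R by [].
have [u u_min] := @oracle_risk_min R n sigma n0 121 mu c0.
have minE : is_minimum [set oracle_risk 121 sigma mu v | v in [set: 'cV[R]_n]]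
    (oracle_risk 121 sigma mu u).
  by split; [exists u|move=> _ [v _ <-]; exact: u_min].
have [S [mS S0 S1 SP]] := noise_control (jumps u) n0 sigma0 iso.
pose risk w := sqnorm (muQ (y w) - mu).
have riskE w l : 0 <= l -> ln (S w) <= l ->
    risk w <= oracle_risk 111 sigma mu u + 10 * sigma ^+ 2 * l / n%:R.
  move=> l0 Sl; apply: aggregate_risk_bound => // J.
  apply: (le_trans (SP w J)); rewrite ler_pM2l ?exprn_gt0//.
  by rewrite lerD2l.
have mrisk : measurable_fun setT risk.
  apply: (@continuous_measurable_fun_cV _ _ _ _ y _
    (fun z => sqnorm (muQ z - mu))).
    move=> i; rewrite /y; under eq_fun do rewrite !mxE.
    exact: measurable_funD.
  exact (@risk_continuous R n sigma n0 thetahat mu th_min).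
have risk0 w : 0 <= risk w.
  by rewrite /risk sqnormE mulr_ge0 ?invr_ge0 ?dot_ge0// ltW.
have r111 : oracle_risk 111 sigma mu u + 10 * sigma ^+ 2 / n%:R <=
    oracle_risk 121 sigma mu u.
  apply: (le_trans (@oracle_riskD R n 111 10 sigma mu u n0 _)) => //.
  by rewrite (_ : 111 + 10 = 121 :> R)//; lra.
have sn0 : 0 <= 10 * sigma ^+ 2 / n%:R.
  by rewrite divr_ge0 ?ler0n// mulr_ge0// sqr_ge0.
split; exists (oracle_risk 121 sigma mu u); split=> //.
- move=> delta d0 d3.
  apply: (@le_trans _ _ (1 - delta)%:E); first by rewrite lee_fin; lra.
  apply: (le_trans (markov_mean_le1 mS (fun w => ltW (S0 w)) S1 d0)).
  have ln0 : 0 <= ln (1 / delta).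
    by rewrite ln_ge0// ler_pdivlMr// mul1r; lra.
  apply: le_measure; rewrite ?inE.
  + rewrite (_ : [set w | _] = S @^-1` `]-oo, 1 / delta]); last first.
      by apply/seteqP; split=> w; rewrite /= in_itv.
    by rewrite -[_ @^-1` _]setTI; exact: mS.
  + set b := _ + _; rewrite (_ : [set w | _] = risk @^-1` `]-oo, b]); last first.
      by apply/seteqP; split=> w; rewrite /= in_itv.
    by rewrite -[_ @^-1` _]setTI; exact: mrisk.
  + move=> w /= Sw.
    have lnS : ln (S w) <= ln (1 / delta) by rewrite ler_ln ?posrE ?divr_gt0.
    apply: (le_trans (riskE _ _ ln0 lnS)); apply: lerD; first by lra.
    rewrite ler_pM2r ?invr_gt0// ler_wpM2r// ler_wpM2r ?sqr_ge0//; lra.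
- rewrite unlock; apply: (@le_trans _ _ (\int[P]_w
    ((oracle_risk 111 sigma mu u)%:E + (10 * sigma ^+ 2 / n%:R)%:E * (S w)%:E))%E).
    apply: ge0_le_integral => //.
    + by move=> w _; rewrite lee_fin; exact: risk0.
    + exact/measurable_EFinP.
    + apply: emeasurable_funD => //; apply: measurable_funeM.
      exact/measurable_EFinP.
    + move=> w _; rewrite -EFinM -EFinD lee_fin.
      have lnS : ln (S w) <= S w.
        have := @le_ln1Dx R (S w - 1); rewrite addrCA subrr addr0 ltrBrDl subrr.
        by move=> /(_ (S0 w))/le_trans; apply; rewrite gerBl.
      apply: (le_trans (riskE _ _ (ltW (S0 w)) lnS)).
      by rewrite lerD2l mulrAC.
  rewrite ge0_integralD//.
  + rewrite integral_cst// [X in (_ * X + _)%E](_ : _ = 1%E); last exact: probability_setT.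
    rewrite mule1 ge0_integralZl//.
    * apply: (@le_trans _ _ (oracle_risk 111 sigma mu u + 10 * sigma ^+ 2 / n%:R)%:E).
        rewrite [leRHS]EFinD; apply: leeD2l.
        apply: (le_trans (lee_wpmul2l _ S1)); first by rewrite lee_fin.
        by rewrite mule1.
      by rewrite lee_fin.
    * exact/measurable_EFinP.
    * by move=> w _; rewrite lee_fin ltW.
  + by move=> w _; rewrite lee_fin oracle_risk_ge0.
  + by move=> w _; rewrite -EFinM lee_fin mulr_ge0// ltW.
  + by apply: measurable_funeM; exact/measurable_EFinP.
Qed.
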